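(* Let $\alpha>-1$ and $\rho>0$. Assume that $f$ is analytic within and on the parabola $P_\rho$ and that, for some $\beta\in\mathbb{R}$ and some constant $\mathcal{K}>0$, $|f(z)|\le \mathcal{K}|z|^{\beta}$ as $z\to\infty$ in $D_\rho$. Then, for each integer $k\ge\max\{\lfloor\beta-1/2\rfloor+1,0\}$, $$a_k^{(\alpha)}=\frac{1}{\gamma_k^{(\alpha)}}\int_{P_\rho}\Phi_k^{(\alpha)}(z)f(z)\,\mathrm{d}z .$$
   Context: $\mathbb{R}_+=[0,\infty)$. For $z\in\mathbb{C}\setminus\mathbb{R}_+$, $\sqrt{-z}$ denotes the branch with cut along the positive real axis that is real and positive for $z<0$. $P_\rho=\{z\in\mathbb{C}:\Re(\sqrt{-z})=\rho\}$ is a parabola opening to the right with vertex $-\rho^2$ and focus $0$, and $D_\rho=\{z\in\mathbb{C}:\Re(\sqrt{-z})<\rho\}$ is its interior (which contains $\mathbb{R}_+$). ''Analytic within and on $P_\rho$'' means analytic in a neighbourhood of $D_\rho\cup P_\rho$. Contour integrals over $P_\rho$ are taken in the counterclockwise direction, i.e. with $D_\rho$ on the left (from $\infty$ in the upper half plane, through $-\rho^2$, to $\infty$ in the lower half plane). $\lfloor\cdot\rfloor$ denotes the integer part. $L_k^{(\alpha)}$ is the generalized Laguerre polynomial of degree $k$, $L_k^{(\alpha)}(x)=\frac{(\alpha+1)_k}{k!}\sum_{j=0}^{k}\frac{(-k)_j}{(\alpha+1)_j}\frac{x^j}{j!}$, where $(z)_j$ is the Pochhammer symbol ($(z)_0=1$,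 $(z)_j=(z)_{j-1}(z+j-1)$). The weight is $\omega_\alpha(x)=x^\alpha e^{-x}$ and $\gamma_k^{(\alpha)}=\Gamma(k+\alpha+1)/k!=\int_{\mathbb{R}_+}L_k^{(\alpha)}(x)^2\omega_\alpha(x)\,\mathrm{d}x$. The Laguerre coefficients of $f$ are $a_k^{(\alpha)}=\frac{1}{\gamma_k^{(\alpha)}}\int_{\mathbb{R}_+}f(x)L_k^{(\alpha)}(x)\omega_\alpha(x)\,\mathrm{d}x$. The weighted Cauchy transform is $$\Phi_k^{(\alpha)}(z)=\frac{1}{2\pi\mathrm{i}}\int_{\mathbb{R}_+}\frac{\omega_\alpha(x)L_k^{(\alpha)}(x)}{z-x}\,\mathrm{d}x,\qquad z\in\mathbb{C}\setminus\mathbb{R}_+ .$$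
   Formalization: The integral over P_ρ is the limit of integrals over symmetric truncations |z| ≤ R, not an ordinary improper integral: for k ≤ β < k+1/2, e.g. k=0 and f(z)=(z+c)^0.3 with c>ρ², the ends of the contour diverge separately. *)

(* Defs.v *)
From Stdlib Require Import Reals Lra ZArith.
From Coquelicot Require Import Coquelicot.

Local Open Scope R_scope.

(* Principal square root: cut along the negative real axis, nonnegative real
   part.  Consequently [Csqrt (- z)] has its cut along the positive real axis
   and is positive for [z < 0].  The value chosen on the cut is purely
   imaginary, so that [Re (Csqrt (- x)) = 0] for real [x >= 0]. *)
Definition Csqrt (w : C) : C :=
  (sqrt ((Cmod w + Re w) / 2),
   (if Rlt_dec (Im w) 0 then -1 else 1) * sqrt ((Cmod w - Re w) / 2)).

Definition on_parabola (rho : R) (z : C) : Prop := Re (Csqrt (- z)) = rho.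

Definition in_parabola (rho : R) (z : C) : Prop := Re (Csqrt (- z)) < rho.

(* [- (rho + i t)^2] and its derivative in [t].  As [t] increases from
   [-infty] to [+infty] the imaginary part [- 2 rho t] decreases, so the
   interior (which contains the focus 0) lies on the left. *)
Definition parabola (rho t : R) : C := (- (rho, t) ^ 2)%C.

Definition parabola' (rho t : R) : C := (- (2 * Ci * (rho, t)))%C.

(* The contour integral is the limit of the integrals over the truncations
   [|t| <= T], i.e. [|z| <= rho^2 + T^2], of the parabola.  Under a growth
   bound [|z|^beta] with [k <= beta < k + 1/2] the two ends need not converge
   separately, so independent truncations of both ends would be too strong. *)
Definition is_parabola_int (rho : R) (g : C -> C) (l : C) : Prop :=
  filterlimi
    (fun T : R => is_RInt (V := C_R_NormedModule)
       (fun t => g (parabola rho t) * parabola' rho t)%C (- T) T)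
    (Rbar_locally p_infty) (locally l).

Definition ex_parabola_int (rho : R) (g : C -> C) : Prop :=
  exists l : C, is_parabola_int rho g l.

Definition parabola_int (rho : R) (g : C -> C) : C :=
  iota (T := C_R_CompleteNormedModule) (is_parabola_int rho g).

Definition holomorphic_on (U : C -> Prop) (f : C -> C) : Prop :=
  forall z : C, U z -> ex_derive (K := C_AbsRing) (V := C_NormedModule) f z.

Definition analytic_within_and_on_parabola (rho : R) (f : C -> C) : Prop :=
  exists U : C -> Prop,
    open U /\
    (forall z : C, in_parabola rho z \/ on_parabola rho z -> U z) /\
    holomorphic_on U f.

(* Improper integrals over [(0, +infty)], with [0] approached from the right
   since the integrands may be singular there. *)
Definition RInt_pos (g : R -> R) : R :=
  RInt_gen (V := R_CompleteNormedModule) g (at_right 0) (Rbar_locally p_infty).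

Definition CInt_pos (g : R -> C) : C :=
  RInt_gen (V := C_R_CompleteNormedModule) g (at_right 0) (Rbar_locally p_infty).

Definition Gamma (s : R) : R :=
  RInt_pos (fun t => Rpower t (s - 1) * exp (- t)).

Fixpoint pochhammer (z : R) (j : nat) : R :=
  match j with
  | O => 1
  | S i => pochhammer z i * (z + INR i)
  end.

Definition Laguerre (alpha : R) (k : nat) (x : R) : R :=
  pochhammer (alpha + 1) k / INR (fact k) *
  sum_f_R0 (fun j => pochhammer (- INR k) j / pochhammer (alpha + 1) j *
                     (x ^ j / INR (fact j))) k.

Definition Laguerre_weight (alpha x : R) : R := Rpower x alpha * exp (- x).

Definition Laguerre_gamma (alpha : R) (k : nat) : R :=
  Gamma (INR k + alpha + 1) / INR (fact k).

Definition Laguerre_coef (alpha : R) (f : C -> C) (k : nat) : C :=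
  (/ RtoC (Laguerre_gamma alpha k) *
   CInt_pos (fun x => f (RtoC x) * RtoC (Laguerre alpha k x)
                      * RtoC (Laguerre_weight alpha x)))%C.

(* Only meaningful for [z] outside [[0, +infty)]. *)
Definition Laguerre_Phi (alpha : R) (k : nat) (z : C) : C :=
  (/ (2 * RtoC PI * Ci) *
   CInt_pos (fun x => RtoC (Laguerre_weight alpha x * Laguerre alpha k x)
                      / (z - RtoC x)))%C.

Lemma Csqrt_sqr (w : C) : (Csqrt w ^ 2)%C = w.
Proof.
destruct w as [a b].
assert (Ha := re_le_Cmod (a, b)). apply Rabs_le_between in Ha.
assert (H2 := Cmod2_alt (a, b)). cbn in Ha, H2.
unfold Csqrt; cbn [Re Im fst snd]; set (m := Cmod (a, b)) in *.
assert (P : sqrt ((m + a) / 2) * sqrt ((m + a) / 2) = (m + a) / 2)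
  by (apply sqrt_sqrt; lra).
assert (Q : sqrt ((m - a) / 2) * sqrt ((m - a) / 2) = (m - a) / 2)
  by (apply sqrt_sqrt; lra).
assert (PQ : 2 * (sqrt ((m + a) / 2) * sqrt ((m - a) / 2)) = Rabs b).
{ rewrite <- sqrt_mult by lra.
  replace ((m + a) / 2 * ((m - a) / 2)) with (Rsqr (b / 2))
    by (unfold Rsqr; nra).
  rewrite sqrt_Rsqr_abs; unfold Rdiv; rewrite Rabs_mult, (Rabs_right (/ 2));
  lra. }
destruct (Rlt_dec b 0) as [Hb | Hb].
- rewrite Rabs_left in PQ by lra.
  unfold Cpow, Cmult, RtoC; cbn; f_equal; nra.
- rewrite Rabs_right in PQ by lra.
  unfold Cpow, Cmult, RtoC; cbn; f_equal; nra.
Qed.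

Lemma Csqrt_re_ge0 (w : C) : 0 <= Re (Csqrt w).
Proof. apply sqrt_pos. Qed.

Lemma parabola_is_derive (rho t : R) :
  is_derive (K := R_AbsRing) (V := C_R_NormedModule)
    (parabola rho) t (parabola' rho t).
Proof.
set (e1 := (1, 0) : C_R_NormedModule).
set (e2 := (0, 1) : C_R_NormedModule).
apply is_derive_ext with
  (fun s => plus (scal (s ^ 2 - rho ^ 2) e1) (scal (- (2 * rho * s)) e2)).
{ intros s; apply injective_projections; cbn; unfold mult; cbn; ring. }
replace (parabola' rho t) with (plus (scal (2 * t) e1) (scal (- (2 * rho)) e2))
  by (apply injective_projections; cbn; unfold mult; cbn; ring).
apply (is_derive_plus (K := R_AbsRing) (V := C_R_NormedModule));
  apply (is_derive_scal_l (K := R_AbsRing) (V := C_R_NormedModule));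
  auto_derive; trivial; ring.
Qed.

Lemma on_parabolaP (rho : R) (z : C) :
  0 < rho -> on_parabola rho z <-> exists t : R, z = parabola rho t.
Proof.
intros Hrho; unfold on_parabola, parabola; split.
- intros H; exists (Im (Csqrt (- z))).
  rewrite <- H, <- surjective_pairing, Csqrt_sqr; ring.
- intros [t ->].
  replace (- - (rho, t) ^ 2)%C with ((rho, t) ^ 2)%C by ring.
  set (w := Csqrt ((rho, t) ^ 2)).
  assert (Hw : ((w - (rho, t)) * (w + (rho, t)) = 0)%C).
  { assert (E := Csqrt_sqr ((rho, t) ^ 2)); fold w in E.
    transitivity (w ^ 2 - (rho, t) ^ 2)%C; [ring | rewrite E; ring]. }
  assert (Hr : 0 <= Re w) by apply Csqrt_re_ge0.
  clearbody w; unfold Re in *.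
  destruct (Ceq_dec (w + (rho, t)) 0) as [E | E].
  + apply (f_equal fst) in E; cbn in E; lra.
  + destruct (Ceq_dec (w - (rho, t)) 0) as [E' | E'].
    * apply (f_equal fst) in E'; cbn in E'; lra.
    * now destruct (Cmult_neq_0 _ _ E' E).
Qed.

(* Main.v *)
Require Import Defs.
From Stdlib Require Import Reals ZArith Lra Lia Psatz ClassicalEpsilon.
From Coquelicot Require Import Coquelicot.

Local Open Scope R_scope.

(** The substitution [z = - w ^ 2] straightens the geometry: the parabola is the
    image of the line [Re w = rho], its interior the image of the strip
    [|Re w| < rho], and the half-line the image of the imaginary axis.  The
    truncated parabola [|t| <= T] is the right edge of the rectangle
    [|Re w| <= rho], [|Im w| <= T].

    For fixed [x > 0], [f z / (z - x) dz] becomes [G w dw] with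
    [G w = 2 w f (- w ^ 2) / (w ^ 2 + x)] up to a constant.  [G] is odd, so
    Cauchy's formula for the upper half of the rectangle ([Cauchy_rect],
    resting on [Goursat]) expresses the integral [kernel_int] of the Cauchy
    kernel over the truncated parabola as [2 PI i f x] plus the integral
    [cap_int] over the top edge ([kernel_int_residue]).  On the top edge [|z|]
    is about [T ^ 2], and splitting off [k] terms of the geometric series of
    [1 / (z - x)] leaves, besides a polynomial of degree less than [k] in [x], a
    remainder [O(x ^ k T ^ (2 beta - 2 k - 1))], which tends to [0] exactly
    because [beta < k + 1 / 2].  For [x] of the order of [T ^ 2] or larger, where
    the cap is of no use, the distance from the parabola to the half-line is at
    least [rho ^ 2] and everything is polynomially bounded in [x].  Altogether
    ([kernel_int_approx]) the kernel integral equals [2 PI i f x] plus a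
    polynomial of degree less than [k], with an error [o(1) (1 + x) ^ n] uniform
    in [x].

    Now integrate against the weight times [L_k].  The polynomial disappears by
    orthogonality ([Laguerre_orthogonal]), the error tends to [0] since all
    moments of the weight are finite, and exchanging the two integrals
    ([Psi_contour_int], from [Fubini_rect] and a uniform bound of the tails)
    turns the kernel integral into the truncated contour integral of the Cauchy
    transform.  Hence the truncated contour integrals converge to the integral
    that defines the coefficient; the factor [1 / gamma_k] is common to
    both sides.

    Goursat's theorem and Fubini's theorem are both obtained by [quadrisection]:
    a quantity additive over rectangles that is locally negligible against
    the square of the diameter vanishes. *)

(** * Continuity and differentiability of complex functions *)

Notation ccont g u := (continuous (U := C_UniformSpace) g u).

Section Continuity.
Context {U : UniformSpace}.
Implicit Types (f g : U -> C) (u : U).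

Lemma ccont_pair (p q : U -> R) u :
  continuous p u -> continuous q u -> ccont (fun v => (p v, q v)) u.
Proof.
intros Hp Hq P [e He].
change (locally u (fun v => P (p v, q v))).
assert (Ap : locally u (fun v => ball (p u) e (p v)))
  by exact (Hp _ (locally_ball (p u) e)).
assert (Aq : locally u (fun v => ball (q u) e (q v)))
  by exact (Hq _ (locally_ball (q u) e)).
generalize (filter_and _ _ Ap Aq); apply filter_imp.
intros v [A B]; apply He; split; assumption.
Qed.

Lemma ccont_Re f u : ccont f u -> continuous (fun v => Re (f v)) u.
Proof. intros H; apply (continuous_comp f fst u H), continuous_fst. Qed.

Lemma ccont_Im f u : ccont f u -> continuous (fun v => Im (f v)) u.
Proof. intros H; apply (continuous_comp f snd u H), continuous_snd. Qed.

Lemma ccont_const (c : C) u : ccont (fun _ : U => c) u.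
Proof. apply continuous_const. Qed.

Lemma ccont_plus f g u :
  ccont f u -> ccont g u -> ccont (fun v => f v + g v)%C u.
Proof.
intros Hf Hg; exact (continuous_plus (V := C_NormedModule) f g u Hf Hg).
Qed.

Lemma ccont_opp f u : ccont f u -> ccont (fun v => - f v)%C u.
Proof. intros Hf; exact (continuous_opp (V := C_NormedModule) f u Hf). Qed.

Lemma ccont_minus f g u :
  ccont f u -> ccont g u -> ccont (fun v => f v - g v)%C u.
Proof. intros Hf Hg; apply ccont_plus; [|apply ccont_opp]; assumption. Qed.

Lemma rcont_plus (p q : U -> R) u :
  continuous p u -> continuous q u -> continuous (fun v => p v + q v) u.
Proof. apply (continuous_plus (V := R_NormedModule)). Qed.

Lemma rcont_minus (p q : U -> R) u :
  continuous p u -> continuous q u -> continuous (fun v => p v - q v) u.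
Proof. apply (continuous_minus (V := R_NormedModule)). Qed.

Lemma rcont_mult (p q : U -> R) u :
  continuous p u -> continuous q u -> continuous (fun v => p v * q v) u.
Proof. apply (continuous_mult (K := R_AbsRing)). Qed.

Lemma ccont_mult f g u :
  ccont f u -> ccont g u -> ccont (fun v => f v * g v)%C u.
Proof.
intros Hf Hg.
assert (Rf := ccont_Re f u Hf); assert (If := ccont_Im f u Hf).
assert (Rg := ccont_Re g u Hg); assert (Ig := ccont_Im g u Hg).
apply (ccont_pair (fun v => Re (f v) * Re (g v) - Im (f v) * Im (g v))
                  (fun v => Re (f v) * Im (g v) + Im (f v) * Re (g v))).
- apply rcont_minus; apply rcont_mult; assumption.
- apply rcont_plus; apply rcont_mult; assumption.
Qed.

Lemma ccont_inv f u : ccont f u -> f u <> 0 -> ccont (fun v => / f v)%C u.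
Proof.
intros Hf H0.
assert (Rf := ccont_Re f u Hf); assert (If := ccont_Im f u Hf).
assert (Hn : continuous (fun v => / (Re (f v) ^ 2 + Im (f v) ^ 2)) u).
{ apply (continuous_comp (fun v => Re (f v) ^ 2 + Im (f v) ^ 2) Rinv).
  - apply (continuous_ext (fun v => Re (f v) * Re (f v) + Im (f v) * Im (f v))).
    { intros v; cbn; ring. }
    apply rcont_plus; apply rcont_mult; assumption.
  - apply continuous_Rinv; rewrite <- Cmod2_alt.
    apply pow_nonzero, Rgt_not_eq, Cmod_gt_0, H0. }
apply (ccont_pair (fun v => Re (f v) / (Re (f v) ^ 2 + Im (f v) ^ 2))
                  (fun v => - Im (f v) / (Re (f v) ^ 2 + Im (f v) ^ 2)));
apply rcont_mult; try exact Hn.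
- exact Rf.
- exact (continuous_opp (V := R_NormedModule) _ u If).
Qed.

Lemma ccont_div f g u :
  ccont f u -> ccont g u -> g u <> 0 -> ccont (fun v => f v / g v)%C u.
Proof. intros Hf Hg H; apply ccont_mult, ccont_inv; assumption. Qed.

Lemma ccont_pow f n u : ccont f u -> ccont (fun v => f v ^ n)%C u.
Proof.
intros Hf; induction n; [apply ccont_const | apply ccont_mult; assumption].
Qed.

Lemma ccont_RtoC (p : U -> R) u :
  continuous p u -> ccont (fun v => RtoC (p v)) u.
Proof. intros H; apply ccont_pair; [assumption | apply continuous_const]. Qed.

Lemma ccont_near f u (e : R) :
  0 < e -> ccont f u -> locally u (fun v => Cmod (f v - f u) < e).
Proof.
intros He Hf.
apply (Hf (fun w => Cmod (w - f u) < e)).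
apply (locally_le_locally_norm (V := C_NormedModule) (f u)).
exists (mkposreal e He); intros y Hy; exact Hy.
Qed.

Lemma ccont_of_near f u :
  (forall e, 0 < e -> locally u (fun v => Cmod (f v - f u) < e)) -> ccont f u.
Proof.
intros H P HP; change (locally u (fun v => P (f v))).
destruct (locally_norm_le_locally (V := C_NormedModule) _ _ HP) as [e He].
generalize (H e (cond_pos e)); apply filter_imp.
intros v Hv; apply He; exact Hv.
Qed.

End Continuity.

Lemma ccont_id (w : C) : ccont (fun v : C_UniformSpace => v) w.
Proof. apply continuous_id. Qed.

Lemma locally_Cmod (w : C) (P : C -> Prop) :
  locally (T := C_UniformSpace) w P <->
  exists d, 0 < d /\ forall v, Cmod (v - w) < d -> P v.
Proof.
split.
- intros H; destruct (locally_norm_le_locally (V := C_NormedModule) _ _ H) as [e He].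
  exists e; split; [apply cond_pos | intros v Hv; apply He; exact Hv].
- intros (d & Hd & H); apply (locally_le_locally_norm (V := C_NormedModule) w).
  exists (mkposreal d Hd); intros v Hv; apply H; exact Hv.
Qed.

Lemma Cmod_minus_sym (z w : C) : Cmod (z - w) = Cmod (w - z).
Proof. rewrite <- Cmod_opp; f_equal; ring. Qed.

Lemma Cmod_tri_minus (z w : C) : Cmod z <= Cmod w + Cmod (z - w).
Proof.
replace z with (w + (z - w))%C at 1 by ring; apply Cmod_triangle.
Qed.

Lemma Cmod_le_Rabs (z : C) : Cmod z <= Rabs (Re z) + Rabs (Im z).
Proof.
replace z with (RtoC (Re z) + Ci * RtoC (Im z))%C at 1
  by (destruct z; unfold Ci, RtoC, Cplus, Cmult; simpl; f_equal; ring).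
eapply Rle_trans; [apply Cmod_triangle|].
rewrite Cmod_mult, Cmod_Ci, !Cmod_R; lra.
Qed.

Ltac cring := lazymatch goal with |- ?a = ?b => change (@eq C a b) end; ring.
Ltac cfield := lazymatch goal with |- ?a = ?b => change (@eq C a b) end; field.

(** Caratheodory's form of complex differentiability: the product, quotient
    and chain rules become identities between the slopes. *)
Definition Cdiff (F : C -> C) (w : C) : Prop :=
  exists phi : C -> C, ccont phi w /\
    locally (T := C_UniformSpace) w (fun v => F v - F w = phi v * (v - w))%C.

Lemma Cdiff_cont F w : Cdiff F w -> ccont F w.
Proof.
intros (phi & Hc & H).
apply (continuous_ext_loc F (fun v : C_UniformSpace => F w + phi v * (v - w))%C).
- generalize H; apply filter_imp; intros v Hv; rewrite <- Hv; cring.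
- apply ccont_plus; [apply ccont_const | apply ccont_mult; [exact Hc|]].
  apply ccont_minus; [apply ccont_id | apply ccont_const].
Qed.

Lemma Cdiff_ex_derive F w :
  ex_derive (K := C_AbsRing) (V := C_NormedModule) F w -> Cdiff F w.
Proof.
intros [l [_ Hl]].
set (phi := fun v => if Ceq_dec v w then l else ((F v - F w) / (v - w))%C).
exists phi; split.
- apply ccont_of_near; intros e He.
  assert (He2 : 0 < e / 2) by lra.
  specialize (Hl w (fun P H => H) (mkposreal _ He2)); simpl in Hl.
  apply locally_C in Hl; generalize Hl; apply filter_imp; intros v Hv.
  unfold phi; destruct (Ceq_dec w w) as [_|n]; [|now elim n].
  destruct (Ceq_dec v w) as [E|n].
  { replace (l - l)%C with (RtoC 0) by cring; rewrite Cmod_0; lra. }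
  assert (n' : (v - w)%C <> 0) by now apply Cminus_eq_contra.
  replace ((F v - F w) / (v - w) - l)%C
    with ((F v - F w - (v - w) * l) / (v - w))%C by (field; exact n').
  rewrite Cmod_div by exact n'.
  assert (P : 0 < Cmod (v - w)) by now apply Cmod_gt_0.
  apply Rle_lt_trans with (e / 2); [|lra].
  apply Rle_div_l; [exact P | exact Hv].
- apply filter_forall; intros v; unfold phi; destruct (Ceq_dec v w) as [->|n].
  + cring.
  + cfield; now apply Cminus_eq_contra.
Qed.

Lemma Cdiff_const c w : Cdiff (fun _ => c) w.
Proof.
exists (fun _ => RtoC 0); split; [apply ccont_const|].
apply filter_forall; intros v; cring.
Qed.

Lemma Cdiff_id w : Cdiff (fun v => v) w.
Proof.
exists (fun _ => RtoC 1); split; [apply ccont_const|].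
apply filter_forall; intros v; cring.
Qed.

Lemma Cdiff_plus F G w : Cdiff F w -> Cdiff G w -> Cdiff (fun v => F v + G v)%C w.
Proof.
intros (p & Hp & Ep) (q & Hq & Eq).
exists (fun v => p v + q v)%C; split; [now apply ccont_plus|].
generalize (filter_and _ _ Ep Eq); apply filter_imp; intros v [A B].
transitivity ((F v - F w) + (G v - G w))%C; [cring|]; rewrite A, B; cring.
Qed.

Lemma Cdiff_mult F G w : Cdiff F w -> Cdiff G w -> Cdiff (fun v => F v * G v)%C w.
Proof.
intros HF HG; assert (CG := Cdiff_cont _ _ HG).
destruct HF as (p & Hp & Ep), HG as (q & Hq & Eq).
exists (fun v => p v * G v + F w * q v)%C; split.
- apply ccont_plus; apply ccont_mult; trivial; apply ccont_const.
- generalize (filter_and _ _ Ep Eq); apply filter_imp; intros v [A B].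
  transitivity ((F v - F w) * G v + F w * (G v - G w))%C; [cring|].
  rewrite A, B; cring.
Qed.

Lemma ccont_neq0 (F : C -> C) w :
  ccont F w -> F w <> 0 -> locally (T := C_UniformSpace) w (fun v => F v <> 0).
Proof.
intros HF H0; assert (P : 0 < Cmod (F w)) by now apply Cmod_gt_0.
generalize (ccont_near _ _ _ P HF); apply filter_imp; intros v Hv E.
rewrite E in Hv; replace (0 - F w)%C with (- F w)%C in Hv by cring.
rewrite Cmod_opp in Hv; lra.
Qed.

Lemma Cdiff_inv F w : Cdiff F w -> F w <> 0 -> Cdiff (fun v => / F v)%C w.
Proof.
intros HF H0; assert (CF := Cdiff_cont _ _ HF); destruct HF as (p & Hp & Ep).
exists (fun v => - p v / (F v * F w))%C; split.
- apply ccont_div; [now apply ccont_opp | |now apply Cmult_neq_0].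
  apply ccont_mult; [exact CF | apply ccont_const].
- generalize (filter_and _ _ Ep (ccont_neq0 _ _ CF H0)); apply filter_imp.
  intros v [A B].
  transitivity (- (F v - F w) / (F v * F w))%C; [cfield; now split|].
  rewrite A; cfield; now split.
Qed.

Lemma Cdiff_comp F G w : Cdiff G w -> Cdiff F (G w) -> Cdiff (fun v => F (G v)) w.
Proof.
intros HG; assert (CG := Cdiff_cont _ _ HG); destruct HG as (q & Hq & Eq).
intros (p & Hp & Ep).
exists (fun v => p (G v) * q v)%C; split.
- apply ccont_mult; [|exact Hq]; exact (continuous_comp G p w CG Hp).
- assert (Ep' : locally (T := C_UniformSpace) w
      (fun v => F (G v) - F (G w) = p (G v) * (G v - G w))%C) by exact (CG _ Ep).
  generalize (filter_and _ _ Ep' Eq); apply filter_imp; intros v [A B].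
  rewrite A, B; cring.
Qed.

Lemma Cdiff_opp F w : Cdiff F w -> Cdiff (fun v => - F v)%C w.
Proof.
intros (p & Hp & Ep); exists (fun v => - p v)%C; split; [now apply ccont_opp|].
generalize Ep; apply filter_imp; intros v A.
transitivity (- (F v - F w))%C; [cring|]; rewrite A; cring.
Qed.

(** * Subdividing rectangles *)

Lemma nested_point (a b : nat -> R) :
  (forall n, a n <= a (S n)) -> (forall n, b (S n) <= b n) ->
  (forall n, a n <= b n) -> exists x, forall n, a n <= x <= b n.
Proof.
intros Ha Hb Hab.
assert (Ma : forall n p, a n <= a (n + p)%nat).
{ intros n p; induction p; [rewrite Nat.add_0_r; lra|].
  rewrite Nat.add_succ_r; eapply Rle_trans; [exact IHp | apply Ha]. }
assert (Mb : forall n p, b (n + p)%nat <= b n).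
{ intros n p; induction p; [rewrite Nat.add_0_r; lra|].
  rewrite Nat.add_succ_r; eapply Rle_trans; [apply Hb | exact IHp]. }
assert (M : forall n p, a n <= b p).
{ intros n p.
  apply Rle_trans with (a (n + p)%nat); [apply Ma|].
  apply Rle_trans with (b (n + p)%nat); [apply Hab|].
  rewrite Nat.add_comm; apply Mb. }
destruct (completeness (fun x => exists n, x = a n)) as [x [H1 H2]].
- exists (b O); intros y [n ->]; apply M.
- exists (a O), O; reflexivity.
- exists x; intros n; split.
  + apply H1; now exists n.
  + apply H2; intros y [p ->]; apply M.
Qed.

Lemma half_pow_lt (L d : R) : 0 < d -> exists n, L * (/ 2) ^ n < d.
Proof.
intros Hd.
assert (HL : 0 < Rabs L + 1) by (assert (Q := Rabs_pos L); lra).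
destruct (pow_lt_1_zero (/ 2) ltac:(rewrite Rabs_right; lra) (d / (Rabs L + 1)))
  as [n Hn].
- now apply Rdiv_lt_0_compat.
- exists n; specialize (Hn n (Nat.le_refl n)).
  assert (P : 0 < (/ 2) ^ n) by (apply pow_lt; lra).
  rewrite Rabs_right in Hn by lra.
  apply Rlt_div_r in Hn; [|exact HL].
  assert (Q := Rle_abs L); nra.
Qed.

(** Goursat's quadrisection.  When every point has neighbourhoods in which the
    subadditive size [N] is negligible against the square of the diameter,
    a rectangle violating the conclusion has a quarter violating it
    with the same constant, and the nested quarters shrink to a point where
    this is absurd. *)
Lemma quadrisection (N : R -> R -> R -> R -> R) (A B C D : R) :
  A <= B -> C <= D ->
  (forall a b c d, A <= a <= b -> b <= B -> C <= c <= d -> d <= D ->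
     let m := (a + b) / 2 in let n := (c + d) / 2 in
     N a b c d <= N a m c n + N m b c n + N a m n d + N m b n d) ->
  (forall x y, A <= x <= B -> C <= y <= D -> forall eps, 0 < eps ->
     exists delta, 0 < delta /\
       forall a b c d, A <= a <= x -> x <= b <= B -> C <= c <= y -> y <= d <= D ->
         (b - a) + (d - c) < delta ->
         N a b c d <= eps * ((b - a) + (d - c)) ^ 2) ->
  forall eps, 0 < eps -> N A B C D <= eps * ((B - A) + (D - C)) ^ 2.
Proof.
intros HAB HCD Hsub Hloc eps Heps.
apply Rnot_lt_le; intros Hbad.
set (bad := fun q : R * R * R * R => let '(a, b, c, d) := q in
  (A <= a <= b /\ b <= B /\ C <= c <= d /\ d <= D) /\
  eps * ((b - a) + (d - c)) ^ 2 < N a b c d).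
assert (step : forall q, {q' | bad q -> bad q' /\
  let '(a, b, c, d) := q in let '(a', b', c', d') := q' in
  a <= a' /\ b' <= b /\ c <= c' /\ d' <= d /\
  b' - a' = (b - a) * / 2 /\ d' - c' = (d - c) * / 2}).
{ intros [[[a b] c] d].
  set (m := (a + b) / 2); set (n := (c + d) / 2).
  apply constructive_indefinite_description.
  destruct (classic (bad (a, b, c, d))) as [Hq|Hq];
    [|exists (a, b, c, d); intros H; now elim Hq].
  destruct Hq as [(h1 & h2 & h3 & h4) h5].
  specialize (Hsub a b c d h1 h2 h3 h4); simpl in Hsub; fold m n in Hsub.
  (* [e] is the bound allowed for a quarter: one fourth of the bound for the
     whole, so that four quarters within it contradict [h5]. *)
  set (e := eps * ((b - a) / 2 + (d - c) / 2) ^ 2).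
  assert (He : 4 * e = eps * ((b - a) + (d - c)) ^ 2) by (unfold e; field).
  assert (Hm : m - a = (b - a) * / 2 /\ b - m = (b - a) * / 2)
    by (unfold m; split; field).
  assert (Hn : n - c = (d - c) * / 2 /\ d - n = (d - c) * / 2)
    by (unfold n; split; field).
  destruct Hm as [Hm1 Hm2], Hn as [Hn1 Hn2].
  destruct (Rlt_dec e (N a m c n)) as [H1|H1];
    [|destruct (Rlt_dec e (N m b c n)) as [H2|H2];
      [|destruct (Rlt_dec e (N a m n d)) as [H3|H3];
        [|destruct (Rlt_dec e (N m b n d)) as [H4|H4]; [|exfalso; lra]]]];
  [exists (a, m, c, n)|exists (m, b, c, n)|exists (a, m, n, d)|exists (m, b, n, d)];
  intros _; unfold bad; rewrite ?Hm1, ?Hm2, ?Hn1, ?Hn2;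
  fold (Rdiv (b - a) 2) (Rdiv (d - c) 2); fold e;
  (split; [split; [|assumption]|]); repeat split; lra. }
set (q := fix q n := match n with
  | O => (A, B, C, D) | S n => proj1_sig (step (q n)) end).
assert (Hq : forall n, bad (q n)).
{ induction n; [simpl; split; [repeat split; lra | exact Hbad]|].
  simpl; destruct (step (q n)) as [q' H]; simpl; apply H, IHn. }
set (a := fun n => fst (fst (fst (q n)))).
set (b := fun n => snd (fst (fst (q n)))).
set (c := fun n => snd (fst (q n))).
set (d := fun n => snd (q n)).
assert (Eq : forall n, q n = (a n, b n, c n, d n)).
{ intros n; unfold a, b, c, d; now destruct (q n) as [[[? ?] ?] ?]. }
assert (Hs : forall n, a n <= a (S n) /\ b (S n) <= b n /\ c n <= c (S n) /\
  d (S n) <= d n /\ b (S n) - a (S n) = (b n - a n) * / 2 /\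
  d (S n) - c (S n) = (d n - c n) * / 2).
{ intros n; assert (E := Eq (S n)); assert (E0 := Eq n).
  assert (H0 := Hq n); simpl in E; rewrite E0 in *.
  destruct (step (a n, b n, c n, d n)) as [q' H]; simpl in E; subst q'.
  apply (H H0). }
assert (Hr : forall n, (A <= a n <= b n /\ b n <= B /\ C <= c n <= d n /\ d n <= D) /\
  eps * ((b n - a n) + (d n - c n)) ^ 2 < N (a n) (b n) (c n) (d n)).
{ intros n; assert (H := Hq n); rewrite Eq in H; exact H. }
destruct (nested_point a b) as [x Hx]; try (intros n; apply (Hs n) || apply (Hr n)).
destruct (nested_point c d) as [y Hy]; try (intros n; apply (Hs n) || apply (Hr n)).
assert (Hw : forall n, (b n - a n) + (d n - c n) = ((B - A) + (D - C)) * (/ 2) ^ n).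
{ induction n; [unfold a, b, c, d; simpl; ring|].
  destruct (Hs n) as (_ & _ & _ & _ & E1 & E2).
  rewrite E1, E2; simpl; rewrite (Rmult_comm (/ 2)), <- Rmult_assoc, <- IHn; ring. }
destruct (Hloc x y) with (eps := eps) as (delta & Hd & H); trivial.
{ specialize (Hx O); unfold a, b in Hx; simpl in Hx; exact Hx. }
{ specialize (Hy O); unfold c, d in Hy; simpl in Hy; exact Hy. }
destruct (half_pow_lt ((B - A) + (D - C)) delta Hd) as [n Hn].
rewrite <- Hw in Hn.
destruct (Hr n) as [(h1 & h2 & h3 & h4) h5].
specialize (Hx n); specialize (Hy n).
specialize (H (a n) (b n) (c n) (d n)); lra.
Qed.

(** * Integrals of complex-valued functions of a real variable *)

Notation is_CInt g a b l := (is_RInt (V := C_R_NormedModule) g a b l).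

Definition CInt (g : R -> C) (a b : R) : C :=
  RInt (V := C_R_CompleteNormedModule) g a b.

Lemma CInt_unique g a b l : is_CInt g a b l -> CInt g a b = l.
Proof. apply (is_RInt_unique (V := C_R_CompleteNormedModule)). Qed.

Lemma is_CInt_cont (g : R -> C) a b :
  a <= b -> (forall t, a <= t <= b -> ccont g t) -> is_CInt g a b (CInt g a b).
Proof.
intros H Hg; apply (RInt_correct (V := C_R_CompleteNormedModule)).
apply (ex_RInt_continuous (V := C_R_CompleteNormedModule)).
rewrite Rmin_left, Rmax_right by exact H; exact Hg.
Qed.

Lemma is_CInt_ext g h a b l :
  a <= b -> (forall t, a < t < b -> g t = h t) -> is_CInt g a b l -> is_CInt h a b l.
Proof.
intros Hab H; apply (is_RInt_ext (V := C_R_NormedModule)).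
rewrite Rmin_left, Rmax_right by exact Hab; exact H.
Qed.

Lemma is_CInt_plus g h a b l m :
  is_CInt g a b l -> is_CInt h a b m -> is_CInt (fun t => g t + h t)%C a b (l + m)%C.
Proof. apply (is_RInt_plus (V := C_R_NormedModule)). Qed.

Lemma is_CInt_minus g h a b l m :
  is_CInt g a b l -> is_CInt h a b m -> is_CInt (fun t => g t - h t)%C a b (l - m)%C.
Proof. apply (is_RInt_minus (V := C_R_NormedModule)). Qed.

Lemma is_CInt_Chasles g a b c l m :
  is_CInt g a b l -> is_CInt g b c m -> is_CInt g a c (l + m)%C.
Proof. apply (is_RInt_Chasles (V := C_R_NormedModule)). Qed.

Lemma is_CInt_scal g a b l (c : C) :
  is_CInt g a b l -> is_CInt (fun t => c * g t)%C a b (c * l)%C.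
Proof.
intros H.
assert (H1 := is_RInt_fct_extend_fst (U := R_NormedModule) (V := R_NormedModule) _ _ _ _ H).
assert (H2 := is_RInt_fct_extend_snd (U := R_NormedModule) (V := R_NormedModule) _ _ _ _ H).
apply (is_RInt_fct_extend_pair (U := R_NormedModule) (V := R_NormedModule)).
- exact (is_RInt_minus _ _ _ _ _ _ (is_RInt_scal _ _ _ (fst c) _ H1)
           (is_RInt_scal _ _ _ (snd c) _ H2)).
- exact (is_RInt_plus _ _ _ _ _ _ (is_RInt_scal _ _ _ (fst c) _ H2)
           (is_RInt_scal _ _ _ (snd c) _ H1)).
Qed.

Lemma is_CInt_RtoC (p : R -> R) a b l :
  is_RInt p a b l -> is_CInt (fun t => RtoC (p t)) a b (RtoC l).
Proof.
intros H; apply (is_RInt_fct_extend_pair (U := R_NormedModule) (V := R_NormedModule)).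
- exact H.
- assert (Z := is_RInt_const (V := R_NormedModule) a b zero).
  change (is_RInt (V := R_NormedModule) (fun _ => 0) a b ((b - a) * 0)) in Z.
  rewrite Rmult_0_r in Z; exact Z.
Qed.

Lemma is_CInt_const (c : C) a b : is_CInt (fun _ => c) a b (c * RtoC (b - a))%C.
Proof.
assert (Z := is_RInt_const (V := C_R_NormedModule) a b c).
rewrite scal_R_Cmult, Cmult_comm in Z; exact Z.
Qed.

Lemma is_CInt_norm_le g (p : R -> R) a b l m :
  a <= b -> (forall t, a <= t <= b -> Cmod (g t) <= p t) ->
  is_CInt g a b l -> is_RInt p a b m -> Cmod l <= m.
Proof.
intros Hab H Hl Hm; rewrite Cmod_norm.
apply (norm_RInt_le (V := C_R_NormedModule) g p a b l m Hab); trivial.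
intros t Ht; specialize (H t Ht); rewrite Cmod_norm in H; exact H.
Qed.

Lemma is_CInt_norm_const g a b l M :
  a <= b -> (forall t, a <= t <= b -> Cmod (g t) <= M) ->
  is_CInt g a b l -> Cmod l <= M * (b - a).
Proof.
intros Hab H Hl.
apply (is_CInt_norm_le g (fun _ => M) a b l); trivial.
rewrite Rmult_comm; exact (is_RInt_const (V := R_NormedModule) a b M).
Qed.

Lemma is_CInt_reflect g a b l :
  is_CInt g (- b) (- a) l -> is_CInt (fun t => g (- t)) a b l.
Proof.
intros H.
assert (H' := is_RInt_swap (V := C_R_NormedModule) _ _ _ _ H).
assert (H2 := is_RInt_comp_opp (V := C_R_NormedModule) _ _ _ _ H').
apply (is_RInt_opp (V := C_R_NormedModule)) in H2.
rewrite opp_opp in H2.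
revert H2; apply (is_RInt_ext (V := C_R_NormedModule)).
intros x _; apply opp_opp.
Qed.

Lemma is_CInt_affine (u v : C) a b :
  is_CInt (fun t => u + v * RtoC t)%C a b
    (u * RtoC (b - a) + v * RtoC ((b ^ 2 - a ^ 2) / 2))%C.
Proof.
apply is_CInt_plus; [apply is_CInt_const|].
apply is_CInt_scal, is_CInt_RtoC.
replace ((b ^ 2 - a ^ 2) / 2) with (minus (b ^ 2 / 2) (a ^ 2 / 2))
  by (unfold minus, plus, opp; simpl; field).
apply (is_RInt_derive (fun t => t ^ 2 / 2) (fun t => t)).
- intros t _; auto_derive; trivial; field.
- intros t _; apply continuous_id.
Qed.

(** * Goursat's theorem and Cauchy's formula for rectangles *)

Lemma C_pairE (s t : R) : ((s, t) : C) = (RtoC s + Ci * RtoC t)%C.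
Proof. unfold Ci, RtoC, Cplus, Cmult; simpl; f_equal; ring. Qed.

Definition rect_int (g : C -> C) (a b c d : R) : C :=
  (CInt (fun s => g (s, c)) a b + Ci * CInt (fun t => g (b, t)) c d
   - CInt (fun s => g (s, d)) a b - Ci * CInt (fun t => g (a, t)) c d)%C.

(** Continuity will be required on the boundary only, since the contour may
    enclose a pole. *)
Definition on_edge (a b c d s t : R) : Prop :=
  a <= s <= b /\ c <= t <= d /\ (s = a \/ s = b \/ t = c \/ t = d).

Definition cont_edges (g : C -> C) (a b c d : R) : Prop :=
  forall s t, on_edge a b c d s t -> ccont g ((s, t) : C).

Lemma ccont_horizontal g s t :
  ccont g ((s, t) : C) -> ccont (fun s' : R => g (s', t)) s.
Proof.
intros H; apply (continuous_comp (fun s' : R => ((s', t) : C_UniformSpace)) g s);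
  [|exact H].
apply (ccont_pair (fun s' => s') (fun _ => t));
  [apply continuous_id | apply continuous_const].
Qed.

Lemma ccont_vertical g s t :
  ccont g ((s, t) : C) -> ccont (fun t' : R => g (s, t')) t.
Proof.
intros H; apply (continuous_comp (fun t' : R => ((s, t') : C_UniformSpace)) g t);
  [|exact H].
apply (ccont_pair (fun _ => s) (fun t' => t'));
  [apply continuous_const | apply continuous_id].
Qed.

Lemma is_CInt_horizontal g a b c d t :
  cont_edges g a b c d -> a <= b -> c <= d -> t = c \/ t = d ->
  is_CInt (fun s => g (s, t)) a b (CInt (fun s => g (s, t)) a b).
Proof.
intros H Hab Hcd Ht; apply is_CInt_cont; [exact Hab|].
intros s Hs; apply ccont_horizontal, H; unfold on_edge; lra.
Qed.

Lemma is_CInt_vertical g a b c d s :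
  cont_edges g a b c d -> a <= b -> c <= d -> s = a \/ s = b ->
  is_CInt (fun t => g (s, t)) c d (CInt (fun t => g (s, t)) c d).
Proof.
intros H Hab Hcd Hs; apply is_CInt_cont; [exact Hcd|].
intros t Ht; apply ccont_vertical, H; unfold on_edge; lra.
Qed.

Lemma CInt_split (h : R -> C) a b m :
  (forall t, a <= t <= b -> ccont h t) -> a <= m <= b ->
  CInt h a b = (CInt h a m + CInt h m b)%C.
Proof.
intros H Hm; apply CInt_unique, is_CInt_Chasles with m;
apply is_CInt_cont; try lra; intros t Ht; apply H; lra.
Qed.

Lemma rect_int_split_x g a b c d m :
  cont_edges g a b c d -> a <= m <= b -> c <= d ->
  rect_int g a b c d = (rect_int g a m c d + rect_int g m b c d)%C.
Proof.
intros H Hm Hcd; unfold rect_int.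
rewrite (CInt_split (fun s => g (s, c)) a b m), (CInt_split (fun s => g (s, d)) a b m);
  try (intros s Hs; apply ccont_horizontal, H; unfold on_edge); try lra.
ring.
Qed.

Lemma rect_int_split_y g a b c d n :
  cont_edges g a b c d -> a <= b -> c <= n <= d ->
  rect_int g a b c d = (rect_int g a b c n + rect_int g a b n d)%C.
Proof.
intros H Hab Hn; unfold rect_int.
rewrite (CInt_split (fun t => g (a, t)) c d n), (CInt_split (fun t => g (b, t)) c d n);
  try (intros t Ht; apply ccont_vertical, H; unfold on_edge); try lra.
ring.
Qed.

Lemma rect_int_affine (u v : C) a b c d :
  rect_int (fun w => u + v * w)%C a b c d = 0.
Proof.
assert (Hh : forall t, CInt (fun s => u + v * (s, t))%C a b =
  ((u + v * Ci * RtoC t) * RtoC (b - a) + v * RtoC ((b ^ 2 - a ^ 2) / 2))%C).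
{ intros t; apply CInt_unique.
  eapply (is_RInt_ext (V := C_R_NormedModule)); [|apply is_CInt_affine].
  intros s _; rewrite (C_pairE s t); cring. }
assert (Hv : forall s, CInt (fun t => u + v * (s, t))%C c d =
  ((u + v * RtoC s) * RtoC (d - c) + v * Ci * RtoC ((d ^ 2 - c ^ 2) / 2))%C).
{ intros s; apply CInt_unique.
  eapply (is_RInt_ext (V := C_R_NormedModule)); [|apply is_CInt_affine].
  intros t _; rewrite (C_pairE s t); cring. }
unfold rect_int; rewrite !Hh, !Hv.
destruct u as [u1 u2], v as [v1 v2].
unfold Ci, RtoC, Cminus, Cplus, Copp, Cmult; simpl; f_equal; field.
Qed.

Lemma rect_int_minus g h a b c d :
  cont_edges g a b c d -> cont_edges h a b c d -> a <= b -> c <= d ->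
  rect_int (fun w => g w - h w)%C a b c d =
  (rect_int g a b c d - rect_int h a b c d)%C.
Proof.
intros Hg Hh Hab Hcd.
assert (E1 : forall t, t = c \/ t = d -> CInt (fun s => g (s, t) - h (s, t))%C a b =
  (CInt (fun s => g (s, t)) a b - CInt (fun s => h (s, t)) a b)%C).
{ intros t Ht; apply CInt_unique, is_CInt_minus;
  eapply is_CInt_horizontal; eassumption. }
assert (E2 : forall s, s = a \/ s = b -> CInt (fun t => g (s, t) - h (s, t))%C c d =
  (CInt (fun t => g (s, t)) c d - CInt (fun t => h (s, t)) c d)%C).
{ intros s Hs; apply CInt_unique, is_CInt_minus;
  eapply is_CInt_vertical; eassumption. }
unfold rect_int; rewrite !E1, !E2 by auto; ring.
Qed.

Lemma rect_int_bound g a b c d M :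
  cont_edges g a b c d -> a <= b -> c <= d ->
  (forall s t, on_edge a b c d s t -> Cmod (g (s, t)) <= M) ->
  Cmod (rect_int g a b c d) <= 2 * M * ((b - a) + (d - c)).
Proof.
intros Hg Hab Hcd HM; unfold rect_int.
assert (E1 : forall t, t = c \/ t = d ->
  Cmod (CInt (fun s => g (s, t)) a b) <= M * (b - a)).
{ intros t Ht; eapply is_CInt_norm_const;
    [exact Hab | | eapply is_CInt_horizontal; eassumption].
  intros s Hs; apply HM; unfold on_edge; lra. }
assert (E2 : forall s, s = a \/ s = b ->
  Cmod (CInt (fun t => g (s, t)) c d) <= M * (d - c)).
{ intros s Hs; eapply is_CInt_norm_const;
    [exact Hcd | | eapply is_CInt_vertical; eassumption].
  intros t Ht; apply HM; unfold on_edge; lra. }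
assert (A1 := E1 c ltac:(lra)); assert (A2 := E1 d ltac:(lra)).
assert (A3 := E2 a ltac:(lra)); assert (A4 := E2 b ltac:(lra)).
unfold Cminus.
eapply Rle_trans; [apply Cmod_triangle|].
eapply Rle_trans; [apply Rplus_le_compat_r, Cmod_triangle|].
eapply Rle_trans; [apply Rplus_le_compat_r, Rplus_le_compat_r, Cmod_triangle|].
rewrite !Cmod_opp, !Cmod_mult, !Cmod_Ci; lra.
Qed.

Lemma Cmod_pair_le (s t x y : R) (D E : R) :
  Rabs (s - x) <= D -> Rabs (t - y) <= E -> Cmod (((s, t) : C) - (x, y))%C <= D + E.
Proof.
intros H1 H2; eapply Rle_trans; [apply Cmod_le_Rabs|]; simpl.
unfold Rminus in *; lra.
Qed.

(** Near a point of differentiability, [g] differs from an affine function,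
    whose contour integral vanishes, by [o(diameter)]; integrating over the
    perimeter gives [o(diameter ^ 2)], which is what quadrisection asks for. *)
Lemma Goursat g a b c d :
  a <= b -> c <= d ->
  (forall s t, a <= s <= b -> c <= t <= d -> Cdiff g ((s, t) : C)) ->
  rect_int g a b c d = 0.
Proof.
intros Hab Hcd Hg.
assert (Cg : forall a' b' c' d', a <= a' -> b' <= b -> c <= c' -> d' <= d ->
  cont_edges g a' b' c' d').
{ intros a' b' c' d' ? ? ? ? s t (Hs & Ht & _); apply Cdiff_cont, Hg; lra. }
apply Cmod_eq_0, Rle_antisym; [|apply Cmod_ge_0].
assert (Q := quadrisection (fun a b c d => Cmod (rect_int g a b c d)) a b c d Hab Hcd).
cbv beta in Q; apply le_epsilon; intros e He; rewrite Rplus_0_l.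
set (L := (b - a + (d - c)) ^ 2).
assert (HL : 0 <= L) by (unfold L; nra).
assert (He' : 0 < e / (L + 1)) by (apply Rdiv_lt_0_compat; lra).
apply Rle_trans with (e / (L + 1) * L).
2:{ apply Rmult_le_reg_r with (L + 1); [lra|].
    replace (e / (L + 1) * L * (L + 1)) with (e * L) by (field; lra); nra. }
apply Q; clear Q; [| |exact He'].
- intros a' b' c' d' ? ? ? ?.
  rewrite (rect_int_split_y g a' b' c' d' ((c' + d') / 2)); try (apply Cg; lra); try lra.
  rewrite (rect_int_split_x g a' b' c' ((c' + d') / 2) ((a' + b') / 2)); try (apply Cg; lra); try lra.
  rewrite (rect_int_split_x g a' b' ((c' + d') / 2) d' ((a' + b') / 2)); try (apply Cg; lra); try lra.
  eapply Rle_trans; [apply Cmod_triangle|].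
  rewrite Rplus_assoc.
  apply Rplus_le_compat; apply Cmod_triangle.
- intros x y Hx Hy eps Heps.
  destruct (Hg x y Hx Hy) as (phi & Cphi & E).
  set (p := (x, y) : C) in *.
  assert (He2 : 0 < eps / 2) by lra.
  assert (Nphi := ccont_near _ _ _ He2 Cphi).
  destruct (proj1 (locally_Cmod _ _) (filter_and _ _ E Nphi)) as (del & Hdel & H).
  exists del; split; [exact Hdel|].
  intros a' b' c' d' h1 h2 h3 h4 Hs.
  set (S := b' - a' + (d' - c')) in *.
  assert (Cg' : cont_edges g a' b' c' d') by (apply Cg; lra).
  set (aff := fun w => ((g p - phi p * p) + phi p * w)%C).
  assert (Caff : cont_edges aff a' b' c' d').
  { intros s t _; apply ccont_plus; [apply ccont_const|].
    apply ccont_mult; [apply ccont_const | apply ccont_id]. }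
  replace (rect_int g a' b' c' d')
    with (rect_int (fun w => g w - aff w)%C a' b' c' d').
  2:{ rewrite rect_int_minus by (trivial; lra).
      unfold aff at 1; rewrite rect_int_affine; ring. }
  replace (eps * S ^ 2) with (2 * (eps / 2 * S) * S) by field; unfold S at 2.
  apply rect_int_bound; try lra.
  { intros s t Hst; apply ccont_minus; [now apply Cg' | now apply Caff]. }
  intros s t (Hs' & Ht' & _).
  assert (HS : Cmod ((s, t) - p) <= S).
  { apply Cmod_pair_le; apply Rabs_le; lra. }
  destruct (H ((s, t) : C)) as [H1 H2]; [lra|].
  replace (g (s, t) - aff (s, t))%C with ((phi (s, t) - phi p) * ((s, t) - p))%C.
  2:{ unfold aff; replace (g (s, t)) with ((g (s, t) - g p) + g p)%C by ring.
      rewrite H1; ring. }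
  rewrite Cmod_mult; apply Rmult_le_compat; try apply Cmod_ge_0; lra.
Qed.

(** With [u = s - x], an antiderivative of [1 / (u + i eta)] is
    [ln (u ^ 2 + eta ^ 2) / 2 - i atan (u / eta)]; the logarithm is even in [u]
    and cancels. *)
Lemma is_CInt_inv_shift (x delta eta : R) :
  0 < delta -> eta <> 0 ->
  is_CInt (fun s => / (RtoC (s - x) + Ci * RtoC eta))%C (x - delta) (x + delta)
    (- (2 * Ci * RtoC (atan (delta / eta))))%C.
Proof.
intros Hd He.
assert (P : forall s, 0 < (s - x) ^ 2 + eta ^ 2).
{ intros s; assert (0 < eta ^ 2) by (rewrite <- Rsqr_pow2; now apply Rsqr_pos_lt).
  generalize (pow2_ge_0 (s - x)); lra. }
set (df := fun s => ((s - x) / ((s - x) ^ 2 + eta ^ 2),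
                     - eta / ((s - x) ^ 2 + eta ^ 2)) : C).
apply is_CInt_ext with df; [lra | |].
{ intros s _; unfold df, Ci, RtoC, Cinv, Cplus, Cmult; simpl.
  specialize (P s); f_equal; field; lra. }
replace (- (2 * Ci * RtoC (atan (delta / eta))))%C
  with ((ln ((x + delta - x) ^ 2 + eta ^ 2) / 2 - ln ((x - delta - x) ^ 2 + eta ^ 2) / 2,
    - atan ((x + delta - x) / eta) - - atan ((x - delta - x) / eta)) : C).
2:{ replace (x + delta - x) with delta by ring.
    replace (x - delta - x) with (- delta) by ring.
    replace (- delta / eta) with (- (delta / eta)) by (field; exact He).
    rewrite atan_opp; replace ((- delta) ^ 2) with (delta ^ 2) by ring.
    unfold Ci, RtoC, Copp, Cmult; simpl; f_equal; ring. }
apply (is_RInt_fct_extend_pair (U := R_NormedModule) (V := R_NormedModule)); unfold df; simpl.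
- apply (is_RInt_derive (fun s => ln ((s - x) ^ 2 + eta ^ 2) / 2)).
  + intros s _; specialize (P s); auto_derive; [exact P | field; lra].
  + intros s _; apply (ex_derive_continuous (K := R_AbsRing) (V := R_NormedModule)).
    specialize (P s); auto_derive; lra.
- apply (is_RInt_derive (fun s => - atan ((s - x) / eta))).
  + intros s _; specialize (P s); auto_derive; [trivial|].
    field; repeat split; try exact He; try lra.
  + intros s _; apply (ex_derive_continuous (K := R_AbsRing) (V := R_NormedModule)).
    specialize (P s); auto_derive; lra.
Qed.

Lemma Cinv_Ci : (/ Ci = - Ci)%C.
Proof. unfold Ci, RtoC, Cinv, Copp; simpl; f_equal; field. Qed.

(** Seen from the centre, each side of the square spans a quarter turn and
    contributes [i PI / 2]. *)
Lemma rect_int_inv (x y delta : R) :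
  0 < delta ->
  rect_int (fun w => / (w - (x, y)))%C (x - delta) (x + delta) (y - delta) (y + delta)
  = (2 * RtoC PI * Ci)%C.
Proof.
intros Hd; unfold rect_int.
assert (Eh : forall eta, eta <> 0 ->
  CInt (fun s => / ((s, (y + eta)%R) - (x, y)))%C (x - delta) (x + delta)
  = (- (2 * Ci * RtoC (atan (delta / eta))))%C).
{ intros eta He; apply CInt_unique.
  eapply is_CInt_ext; [lra | | apply is_CInt_inv_shift; [exact Hd | exact He]].
  intros s _; cbv beta; f_equal.
  unfold Ci, RtoC, Cminus, Copp, Cplus, Cmult; simpl; f_equal; ring. }
assert (Ev : forall eta, eta <> 0 ->
  CInt (fun t => / (((x + eta)%R, t) - (x, y)))%C (y - delta) (y + delta)
  = (- Ci * (- (2 * Ci * RtoC (atan (delta / (- eta))))))%C).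
{ intros eta He; apply CInt_unique.
  eapply is_CInt_ext; [lra | | apply is_CInt_scal, is_CInt_inv_shift; [exact Hd | lra]].
  intros t _; cbv beta.
  assert (E : (((x + eta)%R, t) - (x, y) = Ci * (RtoC (t - y) + Ci * RtoC (- eta)))%C).
  { unfold Ci, RtoC, Cminus, Copp, Cplus, Cmult; simpl; f_equal; ring. }
  assert (N : (RtoC (t - y) + Ci * RtoC (- eta) <> 0)%C).
  { intros H; apply (f_equal snd) in H; simpl in H; apply He; lra. }
  rewrite E, <- Cinv_Ci; cfield; split; [exact N | exact Ci_nz]. }
assert (A1 : atan (delta / delta) = PI / 4).
{ rewrite <- atan_1; f_equal; field; lra. }
assert (A2 : atan (delta / - delta) = - (PI / 4)).
{ rewrite <- A1, <- atan_opp; f_equal; field; lra. }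
assert (E1 := Eh (- delta) ltac:(lra)); assert (E2 := Eh delta ltac:(lra)).
assert (E3 := Ev (- delta) ltac:(lra)); assert (E4 := Ev delta ltac:(lra)).
rewrite Ropp_involutive, ?A1, ?A2 in *.
unfold Rminus in *; rewrite E1, E2, E3, E4.
unfold Ci, RtoC, Cminus, Copp, Cplus, Cmult; simpl; f_equal; field.
Qed.

(** By Goursat the contour shrinks to a small square around the pole, on
    which [F] may be replaced by [F p] with an error that tends to [0]. *)
Lemma Cauchy_rect F a b c d x y :
  a < x < b -> c < y < d ->
  (forall s t, a <= s <= b -> c <= t <= d -> Cdiff F ((s, t) : C)) ->
  rect_int (fun w => F w / (w - (x, y)))%C a b c d = (2 * RtoC PI * Ci * F (x, y))%C.
Proof.
intros Hx Hy HF.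
set (p := (x, y) : C); set (g := fun w => (F w / (w - p))%C).
assert (N : forall s t, s <> x \/ t <> y -> (((s, t) : C) - p)%C <> 0).
{ intros s t Hst E; assert (E1 := f_equal fst E); assert (E2 := f_equal snd E).
  simpl in E1, E2; lra. }
assert (Dg : forall s t, a <= s <= b -> c <= t <= d -> s <> x \/ t <> y ->
  Cdiff g ((s, t) : C)).
{ intros s t Hs Ht Hst; apply Cdiff_mult; [now apply HF|].
  apply Cdiff_inv; [|now apply N].
  apply Cdiff_plus; [apply Cdiff_id | apply Cdiff_const]. }
assert (Sq : forall delta, 0 < delta -> delta < x - a -> delta < b - x ->
  delta < y - c -> delta < d - y ->
  rect_int g a b c d = rect_int g (x - delta) (x + delta) (y - delta) (y + delta)).
{ intros e He H1 H2 H3 H4.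
  assert (CE : forall a' b' c' d', a <= a' < x -> x < b' <= b -> c <= c' < y ->
    y < d' <= d -> cont_edges g a' b' c' d').
  { intros a' b' c' d' ? ? ? ? s t (Hs & Ht & He'); apply Cdiff_cont, Dg; lra. }
  rewrite (rect_int_split_x g a b c d (x - e)); [|apply CE; lra|lra|lra].
  rewrite (rect_int_split_x g (x - e) b c d (x + e)); [|apply CE; lra|lra|lra].
  rewrite (rect_int_split_y g (x - e) (x + e) c d (y - e)); [|apply CE; lra|lra|lra].
  rewrite (rect_int_split_y g (x - e) (x + e) (y - e) d (y + e)); [|apply CE; lra|lra|lra].
  rewrite (Goursat g a (x - e) c d), (Goursat g (x + e) b c d),
    (Goursat g (x - e) (x + e) c (y - e)), (Goursat g (x - e) (x + e) (y + e) d);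
    try lra; [ring | intros s t Hs Ht; apply Dg; lra ..]. }
apply Ceq_minus, Cmod_eq_0, Rle_antisym; [|apply Cmod_ge_0].
apply le_epsilon; intros e He; rewrite Rplus_0_l.
assert (He8 : 0 < e / 8) by lra.
assert (CF := Cdiff_cont _ _ (HF x y ltac:(lra) ltac:(lra))); fold p in CF.
destruct (proj1 (locally_Cmod _ _) (ccont_near _ _ _ He8 CF)) as (r & Hr & Hnear).
set (delta := Rmin (r / 4) (Rmin (Rmin ((x - a) / 2) ((b - x) / 2))
                                 (Rmin ((y - c) / 2) ((d - y) / 2)))).
assert (Hd : 0 < delta) by (unfold delta; repeat apply Rmin_pos; lra).
assert (Hd' : delta <= r / 4 /\ delta <= (x - a) / 2 /\ delta <= (b - x) / 2 /\
              delta <= (y - c) / 2 /\ delta <= (d - y) / 2).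
{ unfold delta; repeat split; unfold Rmin; repeat destruct (Rle_dec _ _); lra. }
rewrite (Sq delta) by lra.
rewrite <- (rect_int_inv x y delta Hd); fold p.
set (h := fun w => (/ (w - p))%C).
assert (Edge : forall s t,
  on_edge (x - delta) (x + delta) (y - delta) (y + delta) s t ->
  delta <= Cmod (((s, t) : C) - p) /\ Cmod (((s, t) : C) - p) < r /\
  (((s, t) : C) - p)%C <> 0 /\ a <= s <= b /\ c <= t <= d /\ (s <> x \/ t <> y)).
{ intros s t (Hs & Ht & Hst).
  assert (B := Rmax_Cmod (((s, t) : C) - p)%C).
  assert (B1 := Rle_trans _ _ _ (Rmax_l _ _) B).
  assert (B2 := Rle_trans _ _ _ (Rmax_r _ _) B).
  simpl in B1, B2.
  assert (U := Cmod_pair_le s t x y delta delta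
    ltac:(apply Rabs_le; lra) ltac:(apply Rabs_le; lra)).
  assert (Hne : s <> x \/ t <> y) by lra.
  repeat split; try lra; [|fold p in U; lra | now apply N].
  destruct Hst as [-> | [-> | [-> | ->]]].
  - rewrite Rabs_left in B1 by lra; lra.
  - rewrite Rabs_right in B1 by lra; lra.
  - rewrite Rabs_left in B2 by lra; lra.
  - rewrite Rabs_right in B2 by lra; lra. }
assert (Ch : cont_edges h (x - delta) (x + delta) (y - delta) (y + delta)).
{ intros s t Hst; apply ccont_inv; [|now apply Edge].
  apply ccont_minus; [apply ccont_id | apply ccont_const]. }
assert (Chc : cont_edges (fun w => F p * h w)%C
   (x - delta) (x + delta) (y - delta) (y + delta)).
{ intros s t Hst; apply ccont_mult; [apply ccont_const | now apply Ch]. }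
assert (Cg : cont_edges g (x - delta) (x + delta) (y - delta) (y + delta)).
{ intros s t Hst; apply Cdiff_cont, Dg; apply (Edge s t Hst). }
assert (Esc : (rect_int h (x - delta) (x + delta) (y - delta) (y + delta) * F p)%C
  = rect_int (fun w => F p * h w)%C (x - delta) (x + delta) (y - delta) (y + delta)).
{ unfold rect_int.
  assert (E1 : forall t, t = y - delta \/ t = y + delta ->
    CInt (fun s => F p * h (s, t))%C (x - delta) (x + delta)
    = (F p * CInt (fun s => h (s, t)) (x - delta) (x + delta))%C).
  { intros t Ht; apply CInt_unique, is_CInt_scal;
    eapply is_CInt_horizontal; try exact Ch; try exact Ht; lra. }
  assert (E2 : forall s, s = x - delta \/ s = x + delta ->
    CInt (fun t => F p * h (s, t))%C (y - delta) (y + delta)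
    = (F p * CInt (fun t => h (s, t)) (y - delta) (y + delta))%C).
  { intros t Ht; apply CInt_unique, is_CInt_scal;
    eapply is_CInt_vertical; try exact Ch; try exact Ht; lra. }
  rewrite !E1, !E2 by auto; ring. }
fold h; rewrite Esc, <- rect_int_minus by (trivial; lra).
apply Rle_trans with (2 * (e / 8 / delta)
  * ((x + delta - (x - delta)) + (y + delta - (y - delta)))).
2:{ apply Req_le; field; lra. }
apply rect_int_bound; try lra.
- intros s t Hst; apply ccont_minus; [now apply Cg | now apply Chc].
- intros s t Hst; destruct (Edge s t Hst) as (H1 & H2 & H3 & H4).
  unfold g, h.
  replace (F (s, t) / ((s, t) - p) - F p * / ((s, t) - p))%C
    with ((F (s, t) - F p) / ((s, t) - p))%C by (field; exact H3).
  rewrite Cmod_div by exact H3.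
  apply Rle_div_l; [lra|].
  apply Rle_trans with (e / 8); [apply Rlt_le, Hnear, H2|].
  replace (e / 8) with (e / 8 / delta * delta) at 1 by (field; lra).
  apply Rmult_le_compat_l; [|exact H1].
  apply Rlt_le, Rdiv_lt_0_compat; lra.
Qed.

(** * Fubini's theorem for continuous functions on rectangles *)

(** A Lebesgue number for neighbourhoods of the points of the segment in which
    [g] varies by at most [eps / 2] provides the tube. *)
Lemma tube_line (g : C -> C) a b t0 eps :
  0 < eps -> (forall s, a <= s <= b -> ccont g ((s, t0) : C)) ->
  exists d, 0 < d /\ forall s t, a <= s <= b -> Rabs (t - t0) < d ->
    Cmod (g (s, t) - g (s, t0))%C <= eps.
Proof.
intros He Hg.
assert (H : forall s, {d : posreal | a <= s <= b ->
  forall s' t', Rabs (s' - s) < d -> Rabs (t' - t0) < d ->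
    Cmod (g (s', t') - g (s, t0))%C <= eps / 2}).
{ intros s; apply constructive_indefinite_description.
  destruct (Rle_dec a s) as [h1|h1]; [|exists (mkposreal 1 Rlt_0_1); lra].
  destruct (Rle_dec s b) as [h2|h2]; [|exists (mkposreal 1 Rlt_0_1); lra].
  assert (He2 : 0 < eps / 2) by lra.
  destruct (proj1 (locally_Cmod _ _) (ccont_near _ _ _ He2 (Hg s (conj h1 h2))))
    as (r & Hr & Hn).
  assert (Hr2 : 0 < r / 2) by lra.
  exists (mkposreal _ Hr2); simpl; intros _ s' t' Hs Ht.
  apply Rlt_le, Hn.
  eapply Rle_lt_trans; [apply Cmod_le_Rabs|]; simpl.
  unfold Rminus in *; lra. }
destruct (compactness_value_1d a b (fun s => proj1_sig (H s))) as [d Hd].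
exists d; split; [apply cond_pos|].
intros s t Hs Ht; apply Rnot_lt_le; intros Hlt.
apply (Hd s Hs); intros (s0 & Hs0 & H1 & H2).
destruct (H s0) as [d0 H0]; simpl in H1, H2.
assert (Q1 := H0 Hs0 s t H1 ltac:(lra)).
assert (Q2 := H0 Hs0 s t0 H1 ltac:(unfold Rminus; rewrite Rplus_opp_r, Rabs_R0; apply cond_pos)).
assert (Q3 := Cmod_triangle (g (s, t) - g (s0, t0)) (- (g (s, t0) - g (s0, t0)))).
rewrite Cmod_opp in Q3.
replace (g (s, t) - g (s0, t0) + - (g (s, t0) - g (s0, t0)))%C
  with (g (s, t) - g (s, t0))%C in Q3 by ring.
lra.
Qed.

Lemma locally_Rabs (x d : R) (P : R -> Prop) :
  0 < d -> (forall y, Rabs (y - x) < d -> P y) -> locally x P.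
Proof. intros Hd H; exists (mkposreal d Hd); intros y Hy; apply H; exact Hy. Qed.

Lemma ccont_param_horizontal (g : C -> C) a b C' D' t :
  a <= b -> C' < t < D' ->
  (forall s t, a <= s <= b -> C' < t < D' -> ccont g ((s, t) : C)) ->
  ccont (fun t => CInt (fun s => g (s, t)) a b) t.
Proof.
intros Hab Ht Hg; apply ccont_of_near; intros e He.
assert (He' : 0 < e / (b - a + 1)) by (apply Rdiv_lt_0_compat; lra).
destruct (tube_line g a b t _ He') as (d & Hd & H); [intros s Hs; now apply Hg|].
apply locally_Rabs with (Rmin d (Rmin (t - C') (D' - t))).
{ repeat apply Rmin_pos; lra. }
intros t' Ht'.
assert (T1 : Rabs (t' - t) < d) by (eapply Rlt_le_trans; [exact Ht' | apply Rmin_l]).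
assert (T2 : C' < t' < D').
{ assert (Q := Rlt_le_trans _ _ _ Ht' (Rmin_r _ _)).
  assert (Q1 := Rlt_le_trans _ _ _ Q (Rmin_l _ _)).
  assert (Q2 := Rlt_le_trans _ _ _ Q (Rmin_r _ _)).
  apply Rabs_lt_between in Q1; apply Rabs_lt_between in Q2; lra. }
apply Rle_lt_trans with (e / (b - a + 1) * (b - a)).
- eapply (is_CInt_norm_const (fun s => g (s, t') - g (s, t))%C a b); [exact Hab| |].
  + intros s Hs; now apply H.
  + apply is_CInt_minus; apply is_CInt_cont; trivial; intros s Hs;
    apply ccont_horizontal, Hg; trivial.
- apply Rmult_lt_reg_r with (b - a + 1); [lra|].
  replace (e / (b - a + 1) * (b - a) * (b - a + 1)) with (e * (b - a)) by (field; lra).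
  nra.
Qed.

Lemma ccont_swap (g : C -> C) s t :
  ccont g ((s, t) : C) -> ccont (fun w => g (snd w, fst w)) ((t, s) : C).
Proof.
intros H.
apply (continuous_comp (fun w : C => ((snd w, fst w) : C_UniformSpace)) g ((t, s) : C)).
- apply (ccont_pair (U := C_UniformSpace) (fun w => snd w) (fun w => fst w));
  [apply continuous_snd | apply continuous_fst].
- exact H.
Qed.

(** The difference of the two iterated integrals is additive over rectangles
    and vanishes for constants, hence is [o(area)] near every point. *)
Lemma Fubini_rect (g : C -> C) A B C' D' a b c d :
  A < a -> a <= b -> b < B -> C' < c -> c <= d -> d < D' ->
  (forall s t, A < s < B -> C' < t < D' -> ccont g ((s, t) : C)) ->
  CInt (fun s => CInt (fun t => g (s, t)) c d) a b =
  CInt (fun t => CInt (fun s => g (s, t)) a b) c d.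
Proof.
intros HA Hab HB HC Hcd HD Hg.
assert (Ct : forall a' b' t, a <= a' <= b' -> b' <= b -> c <= t <= d ->
  ccont (fun t => CInt (fun s => g (s, t)) a' b') t).
{ intros a' b' t ? ? ?; apply ccont_param_horizontal with C' D'; try lra.
  intros s t' ? ?; apply Hg; lra. }
assert (Cs : forall c' d' s, c <= c' <= d' -> d' <= d -> a <= s <= b ->
  ccont (fun s => CInt (fun t => g (s, t)) c' d') s).
{ intros c' d' s ? ? ?.
  apply (ccont_param_horizontal (fun w => g (snd w, fst w)) c' d' A B s); try lra.
  intros t s' ? ?; apply ccont_swap, Hg; lra. }
assert (Ch : forall s t, a <= s <= b -> c <= t <= d -> ccont (fun s => g (s, t)) s).
{ intros s t ? ?; apply ccont_horizontal, Hg; lra. }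
assert (Cv : forall s t, a <= s <= b -> c <= t <= d -> ccont (fun t => g (s, t)) t).
{ intros s t ? ?; apply ccont_vertical, Hg; lra. }
set (I1 := fun a b c d => CInt (fun s => CInt (fun t => g (s, t)) c d) a b).
set (I2 := fun a b c d => CInt (fun t => CInt (fun s => g (s, t)) a b) c d).
change (I1 a b c d = I2 a b c d).
assert (X1 : forall a' m b' c' d', a <= a' <= m -> m <= b' <= b -> c <= c' <= d' ->
  d' <= d -> I1 a' b' c' d' = (I1 a' m c' d' + I1 m b' c' d')%C).
{ intros a' m b' c' d' ? ? ? ?; apply CInt_split; [|lra].
  intros s Hs; apply Cs; lra. }
assert (Y2 : forall a' b' c' n d', a <= a' <= b' -> b' <= b -> c <= c' <= n ->
  n <= d' <= d -> I2 a' b' c' d' = (I2 a' b' c' n + I2 a' b' n d')%C).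
{ intros a' b' c' n d' ? ? ? ?; apply CInt_split; [|lra].
  intros t Ht; apply Ct; lra. }
assert (Y1 : forall a' b' c' n d', a <= a' <= b' -> b' <= b -> c <= c' <= n ->
  n <= d' <= d -> I1 a' b' c' d' = (I1 a' b' c' n + I1 a' b' n d')%C).
{ intros a' b' c' n d' ? ? ? ?; apply CInt_unique.
  apply (is_CInt_ext (fun s => CInt (fun t => g (s, t)) c' n
                               + CInt (fun t => g (s, t)) n d')%C); [lra| |].
  - intros s Hs; symmetry; apply CInt_split; [|lra].
    intros t Ht; apply Cv; lra.
  - apply is_CInt_plus; apply is_CInt_cont; try lra; intros s Hs; apply Cs; lra. }
assert (X2 : forall a' m b' c' d', a <= a' <= m -> m <= b' <= b -> c <= c' <= d' ->
  d' <= d -> I2 a' b' c' d' = (I2 a' m c' d' + I2 m b' c' d')%C).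
{ intros a' m b' c' d' ? ? ? ?; apply CInt_unique.
  apply (is_CInt_ext (fun t => CInt (fun s => g (s, t)) a' m
                               + CInt (fun s => g (s, t)) m b')%C); [lra| |].
  - intros t Ht; symmetry; apply CInt_split; [|lra].
    intros s Hs; apply Ch; lra.
  - apply is_CInt_plus; apply is_CInt_cont; try lra; intros t Ht; apply Ct; lra. }
apply Ceq_minus, Cmod_eq_0, Rle_antisym; [|apply Cmod_ge_0].
apply le_epsilon; intros e He; rewrite Rplus_0_l.
set (L := (b - a + (d - c)) ^ 2).
assert (HL : 0 <= L) by (unfold L; nra).
assert (He' : 0 < e / (L + 1)) by (apply Rdiv_lt_0_compat; lra).
apply Rle_trans with (e / (L + 1) * L).
2:{ apply Rmult_le_reg_r with (L + 1); [lra|].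
    replace (e / (L + 1) * L * (L + 1)) with (e * L) by (field; lra); nra. }
apply (quadrisection (fun a b c d => Cmod (I1 a b c d - I2 a b c d))); trivial.
- intros a' b' c' d' ? ? ? ?; cbv zeta.
  rewrite (X1 a' ((a' + b') / 2) b' c' d'), (X2 a' ((a' + b') / 2) b' c' d') by lra.
  rewrite (Y1 a' ((a' + b') / 2) c' ((c' + d') / 2) d'),
    (Y2 a' ((a' + b') / 2) c' ((c' + d') / 2) d'),
    (Y1 ((a' + b') / 2) b' c' ((c' + d') / 2) d'),
    (Y2 ((a' + b') / 2) b' c' ((c' + d') / 2) d') by lra.
  set (m := (a' + b') / 2); set (n := (c' + d') / 2).
  replace (I1 a' m c' n + I1 a' m n d' + (I1 m b' c' n + I1 m b' n d') -
   (I2 a' m c' n + I2 a' m n d' + (I2 m b' c' n + I2 m b' n d')))%C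
   with ((I1 a' m c' n - I2 a' m c' n) + (I1 m b' c' n - I2 m b' c' n)
     + (I1 a' m n d' - I2 a' m n d') + (I1 m b' n d' - I2 m b' n d'))%C by ring.
  eapply Rle_trans; [apply Cmod_triangle|]; apply Rplus_le_compat_r.
  eapply Rle_trans; [apply Cmod_triangle|]; apply Rplus_le_compat_r.
  apply Cmod_triangle.
- intros x y Hx Hy eps Heps.
  assert (He2 : 0 < eps / 2) by lra.
  destruct (proj1 (locally_Cmod _ _) (ccont_near _ _ _ He2 (Hg x y ltac:(lra) ltac:(lra))))
    as (r & Hr & Hn).
  exists r; split; [exact Hr|].
  intros a' b' c' d' h1 h2 h3 h4 Hs.
  assert (Near : forall s t, a' <= s <= b' -> c' <= t <= d' ->
    Cmod (g (s, t) - g (x, y)) <= eps / 2).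
  { intros s t ? ?; apply Rlt_le, Hn.
    eapply Rle_lt_trans; [|exact Hs].
    apply Cmod_pair_le; apply Rabs_le; lra. }
  set (k := (g (x, y) * RtoC ((b' - a') * (d' - c')))%C).
  assert (B1 : Cmod (I1 a' b' c' d' - k) <= eps / 2 * (d' - c') * (b' - a')).
  { eapply (is_CInt_norm_const
      (fun s => CInt (fun t => g (s, t)) c' d' - g (x, y) * RtoC (d' - c'))%C);
      [lra | | replace k with (g (x, y) * RtoC (d' - c') * RtoC (b' - a'))%C
               by (unfold k; rewrite RtoC_mult; ring);
               apply is_CInt_minus;
               [apply is_CInt_cont; [lra | intros s ?; apply Cs; lra]
               | apply is_CInt_const]].
    intros s ?.
    eapply (is_CInt_norm_const (fun t => g (s, t) - g (x, y))%C);
      [lra | | apply is_CInt_minus; [apply is_CInt_cont; [lra | intros t ?; apply Cv; lra]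
               | apply is_CInt_const]].
    intros t ?; now apply Near. }
  assert (B2 : Cmod (I2 a' b' c' d' - k) <= eps / 2 * (b' - a') * (d' - c')).
  { eapply (is_CInt_norm_const
      (fun t => CInt (fun s => g (s, t)) a' b' - g (x, y) * RtoC (b' - a'))%C);
      [lra | | replace k with (g (x, y) * RtoC (b' - a') * RtoC (d' - c'))%C
               by (unfold k; rewrite RtoC_mult; ring);
               apply is_CInt_minus;
               [apply is_CInt_cont; [lra | intros t ?; apply Ct; lra]
               | apply is_CInt_const]].
    intros t ?.
    eapply (is_CInt_norm_const (fun s => g (s, t) - g (x, y))%C);
      [lra | | apply is_CInt_minus; [apply is_CInt_cont; [lra | intros s ?; apply Ch; lra]
               | apply is_CInt_const]].
    intros s ?; now apply Near. }
  replace (I1 a' b' c' d' - I2 a' b' c' d')%C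
    with ((I1 a' b' c' d' - k) + - (I2 a' b' c' d' - k))%C by ring.
  eapply Rle_trans; [apply Cmod_triangle|]; rewrite Cmod_opp.
  assert (0 <= b' - a') by lra; assert (0 <= d' - c') by lra.
  apply Rle_trans with (eps * ((b' - a') * (d' - c'))); [lra|].
  apply Rmult_le_compat_l; [lra|]; nra.
Qed.

(** * Dominated improper integrals over the positive half-line *)

Notation is_CInt_pos g l :=
  (is_RInt_gen (V := C_R_NormedModule) g (at_right 0) (Rbar_locally p_infty) l).

Lemma CInt_pos_unique g l : is_CInt_pos g l -> CInt_pos g = l.
Proof. apply (is_RInt_gen_unique (V := C_R_CompleteNormedModule)). Qed.

Lemma filter_prod_pos (Q : R -> R -> Prop) :
  filter_prod (at_right 0) (Rbar_locally p_infty) (fun ab => Q (fst ab) (snd ab)) <->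
  exists d B, 0 < d /\ forall a b, 0 < a < d -> B < b -> Q a b.
Proof.
split.
- intros [U V [d Hd] [B HB] H].
  exists d, B; split; [apply cond_pos|]; intros a b Ha Hb.
  apply (H a b); [|now apply HB].
  apply Hd; [|lra].
  apply (norm_compat1 (V := R_NormedModule)); simpl.
  unfold norm; simpl; unfold abs, minus, plus, opp; simpl.
  apply Rabs_lt_between; lra.
- intros (d & B & Hd & H).
  apply (Filter_prod _ _ _ (fun a => 0 < a < d) (fun b => B < b)).
  + exists (mkposreal d Hd); intros y Hy Hy0; split; [exact Hy0|].
    unfold ball in Hy; simpl in Hy; unfold AbsRing_ball, abs, minus, plus, opp in Hy.
    simpl in Hy; apply Rabs_lt_between in Hy; lra.
  + now exists B.
  + exact H.
Qed.

Lemma is_CInt_pos_iff g l :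
  is_CInt_pos g l <->
  forall e, 0 < e -> exists d B, 0 < d /\ forall a b, 0 < a < d -> B < b ->
    exists y, is_CInt g a b y /\ Cmod (y - l) < e.
Proof.
split.
- intros H e He.
  apply (filter_prod_pos (fun a b => exists y, is_CInt g a b y /\ Cmod (y - l) < e)).
  apply (H (fun y => Cmod (y - l) < e)).
  apply (proj2 (locally_Cmod l _)); exists e; auto.
- intros H P HP.
  destruct (proj1 (locally_Cmod l P) HP) as (e & He & HPe).
  apply (proj2 (filter_prod_pos (fun a b => exists y, is_CInt g a b y /\ P y))).
  destruct (H e He) as (d & B & Hd & Hab).
  exists d, B; split; [exact Hd|]; intros a b Ha Hb.
  destruct (Hab a b Ha Hb) as (y & Hy & Hy'); exists y; split; [exact Hy|].
  now apply HPe.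
Qed.

Lemma is_CInt_pos_ext g h l :
  (forall x, 0 < x -> g x = h x) -> is_CInt_pos g l -> is_CInt_pos h l.
Proof.
intros E; rewrite !is_CInt_pos_iff; intros H e He.
destruct (H e He) as (d & B & Hd & Hab).
exists d, (Rmax B d); split; [exact Hd|]; intros a b Ha Hb.
assert (HB := Rmax_l B d); assert (Hd' := Rmax_r B d).
destruct (Hab a b Ha) as (y & Hy & Hy'); [lra|]; exists y; split; [|exact Hy'].
apply is_CInt_ext with g; [lra| |exact Hy]; intros t Ht; apply E; lra.
Qed.

Lemma is_CInt_pos_plus g h (l m : C) :
  is_CInt_pos g l -> is_CInt_pos h m -> is_CInt_pos (fun x => g x + h x)%C (l + m)%C.
Proof. apply (is_RInt_gen_plus (V := C_R_NormedModule)). Qed.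

Lemma is_CInt_pos_scal g (l c : C) :
  is_CInt_pos g l -> is_CInt_pos (fun x => c * g x)%C (c * l)%C.
Proof.
rewrite !is_CInt_pos_iff; intros H e He.
assert (Hc := Cmod_ge_0 c).
destruct (H (e / (Cmod c + 1))) as (d & B & Hd & Hab);
  [apply Rdiv_lt_0_compat; lra|].
exists d, B; split; [exact Hd|]; intros a b Ha Hb.
destruct (Hab a b Ha Hb) as (y & Hy & Hy').
exists (c * y)%C; split; [now apply is_CInt_scal|].
replace (c * y - c * l)%C with (c * (y - l))%C by ring; rewrite Cmod_mult.
apply Rlt_div_r in Hy'; [|lra].
assert (Hy0 := Cmod_ge_0 (y - l)); nra.
Qed.

Lemma is_CInt_pos_minus g h (l m : C) :
  is_CInt_pos g l -> is_CInt_pos h m -> is_CInt_pos (fun x => g x - h x)%C (l - m)%C.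
Proof. apply (is_RInt_gen_minus (V := C_R_NormedModule)). Qed.

(** An explicit distribution function [(x / (1 + x)) ^ (alpha + 1)] of the
    half-line and its density: the density is comparable with [x ^ alpha] at
    [0] and decays like [x ^ (- 2)], so it dominates [x ^ alpha exp (- x)]
    times any polynomial. *)
Definition dom_cdf (alpha x : R) : R := exp ((alpha + 1) * (ln x - ln (1 + x))).
Definition dom_density (alpha x : R) : R :=
  (alpha + 1) * (/ x - / (1 + x)) * dom_cdf alpha x.

Section Dominated.
Variable alpha : R.
Hypothesis Halpha : - 1 < alpha.

Lemma dom_cdf_derive x : 0 < x -> is_derive (dom_cdf alpha) x (dom_density alpha x).
Proof.
intros Hx; unfold dom_cdf, dom_density, dom_cdf; auto_derive; [lra|]; unfold Rminus; field; lra.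
Qed.

Lemma dom_density_cont x : 0 < x -> continuous (dom_density alpha) x.
Proof.
intros Hx; apply (ex_derive_continuous (K := R_AbsRing) (V := R_NormedModule)).
unfold dom_density, dom_cdf; auto_derive; lra.
Qed.

Lemma dom_density_RInt a b :
  0 < a -> a <= b ->
  is_RInt (dom_density alpha) a b (dom_cdf alpha b - dom_cdf alpha a).
Proof.
intros Ha Hab; apply (is_RInt_derive (dom_cdf alpha));
rewrite Rmin_left, Rmax_right by exact Hab; intros x Hx;
[apply dom_cdf_derive | apply dom_density_cont]; lra.
Qed.

Lemma dom_cdf_pos x : 0 < dom_cdf alpha x.
Proof. apply exp_pos. Qed.

Lemma dom_cdf_le1 x : 0 < x -> dom_cdf alpha x <= 1.
Proof.
intros Hx; unfold dom_cdf.
assert (H : ln x < ln (1 + x)) by (apply ln_increasing; lra).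
assert (E : (alpha + 1) * (ln x - ln (1 + x)) < 0) by nra.
apply exp_increasing in E; rewrite exp_0 in E; lra.
Qed.

Lemma dom_cdf_near0 e : 0 < e ->
  exists d, 0 < d /\ forall x, 0 < x < d -> dom_cdf alpha x < e.
Proof.
intros He; exists (exp (ln e / (alpha + 1))); split; [apply exp_pos|].
intros x [Hx Hxd]; unfold dom_cdf; rewrite <- (exp_ln e) at 1 by exact He.
apply exp_increasing.
assert (H : ln x < ln e / (alpha + 1)).
{ rewrite <- (ln_exp (ln e / (alpha + 1))); now apply ln_increasing. }
assert (H1 : 0 < ln (1 + x)) by (rewrite <- ln_1; apply ln_increasing; lra).
apply Rlt_div_r in H; [|lra]; nra.
Qed.

Lemma dom_cdf_near_infty e : 0 < e ->
  exists B, 0 < B /\ forall x, B < x -> 1 - dom_cdf alpha x < e.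
Proof.
intros He; exists ((alpha + 1) / e); split; [apply Rdiv_lt_0_compat; lra|].
intros x Hx.
assert (Hx0 : 0 < x) by (eapply Rlt_trans; [|exact Hx]; apply Rdiv_lt_0_compat; lra).
assert (H1 : ln (1 + x) - ln x <= / x).
{ rewrite <- ln_div by lra.
  replace ((1 + x) / x) with (1 + / x) by (field; lra).
  apply Rle_trans with (ln (exp (/ x))); [|rewrite ln_exp; lra].
  assert (0 < / x) by (apply Rinv_0_lt_compat; lra).
  apply Rlt_le, ln_increasing; [lra | apply exp_ineq1; apply Rgt_not_eq; assumption]. }
assert (H2 := exp_ineq1_le ((alpha + 1) * (ln x - ln (1 + x)))).
unfold dom_cdf.
apply Rlt_div_l in Hx; [|exact He].
assert (H3 : (alpha + 1) * / x < e).
{ apply Rmult_lt_reg_r with x; [exact Hx0|].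
  replace ((alpha + 1) * / x * x) with (alpha + 1) by (field; lra); lra. }
nra.
Qed.

Variables (g : R -> C) (M : R).
Hypothesis Hcont : forall x, 0 < x -> ccont g x.
Hypothesis Hdom : forall x, 0 < x -> Cmod (g x) <= M * dom_density alpha x.

Lemma dominated_ge0 : 0 <= M.
Proof.
assert (H := Rle_trans _ _ _ (Cmod_ge_0 _) (Hdom 1 Rlt_0_1)).
assert (P : 0 < dom_density alpha 1).
{ unfold dom_density; apply Rmult_lt_0_compat; [|apply dom_cdf_pos].
  apply Rmult_lt_0_compat; lra. }
nra.
Qed.

Lemma dominated_segment a b : 0 < a -> a <= b ->
  Cmod (CInt g a b) <= M * (dom_cdf alpha b - dom_cdf alpha a).
Proof.
intros Ha Hab.
apply (is_CInt_norm_le g (fun x => M * dom_density alpha x) a b); trivial.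
- intros t Ht; apply Hdom; lra.
- apply is_CInt_cont; [exact Hab|]; intros t Ht; apply Hcont; lra.
- apply (is_RInt_scal (V := R_NormedModule)); now apply dom_density_RInt.
Qed.

(** Both ends of a larger interval are controlled by the mass that the
    distribution leaves outside the smaller one. *)
Lemma dominated_nested a a' b b' : 0 < a' -> a' <= a -> a <= b -> b <= b' ->
  Cmod (CInt g a' b' - CInt g a b) <= M * (dom_cdf alpha a + (1 - dom_cdf alpha b)).
Proof.
intros Ha Haa Hab Hbb.
rewrite (CInt_split g a' b' a), (CInt_split g a b' b);
  try lra; try (intros t Ht; apply Hcont; lra).
replace (CInt g a' a + (CInt g a b + CInt g b b') - CInt g a b)%C
  with (CInt g a' a + CInt g b b')%C by ring.
eapply Rle_trans; [apply Cmod_triangle|].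
assert (H1 := dominated_segment a' a Ha Haa).
assert (H2 := dominated_segment b b' ltac:(lra) Hbb).
assert (H3 := dom_cdf_pos a'); assert (H4 := dom_cdf_le1 b' ltac:(lra)).
assert (HM := dominated_ge0); nra.
Qed.

Lemma dominated_ex : exists l, is_CInt_pos g l.
Proof.
destruct (proj1 (filterlim_locally_cauchy (U := C_R_CompleteNormedModule)
  (F := filter_prod (at_right 0) (Rbar_locally p_infty))
  (fun ab => CInt g (fst ab) (snd ab)))) as [l Hl].
- intros e.
  assert (HM := dominated_ge0).
  assert (He : 0 < e / (4 * (M + 1))) by (apply Rdiv_lt_0_compat; [apply cond_pos | lra]).
  destruct (dom_cdf_near0 _ He) as (d & Hd & H0).
  destruct (dom_cdf_near_infty _ He) as (B & HB & H1).
  set (a0 := Rmin (d / 2) 1).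
  assert (Ha0 : 0 < a0 /\ a0 <= 1 /\ a0 < d).
  { unfold a0; split; [apply Rmin_pos; lra|]; split; [apply Rmin_r|].
    eapply Rle_lt_trans; [apply Rmin_l | lra]. }
  exists (fun ab => 0 < fst ab < a0 /\ B + 1 < snd ab); split.
  { apply (filter_prod_pos (fun a b => 0 < a < a0 /\ B + 1 < b)).
    exists a0, (B + 1); split; [lra|]; auto. }
  assert (K : forall u : R * R, 0 < fst u < a0 /\ B + 1 < snd u ->
    Cmod (CInt g (fst u) (snd u) - CInt g a0 (B + 1)) < e / 2).
  { intros [a b] [Ha Hb]; simpl in *.
    eapply Rle_lt_trans; [apply dominated_nested; lra|].
    specialize (H0 a0 ltac:(lra)); specialize (H1 (B + 1) ltac:(lra)).
    set (q := e / (4 * (M + 1))) in *.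
    assert (Eq : q * (M + 1) = e / 4) by (unfold q; field; lra).
    assert (He0 := cond_pos e); nra. }
  intros u v Hu Hv.
  apply (norm_compat1 (V := C_NormedModule)).
  change (Cmod (CInt g (fst v) (snd v) - CInt g (fst u) (snd u)) < e).
  replace (CInt g (fst v) (snd v) - CInt g (fst u) (snd u))%C
    with ((CInt g (fst v) (snd v) - CInt g a0 (B + 1))
          + - (CInt g (fst u) (snd u) - CInt g a0 (B + 1)))%C by ring.
  eapply Rle_lt_trans; [apply Cmod_triangle|]; rewrite Cmod_opp.
  specialize (K u Hu) as Ku; specialize (K v Hv); lra.
- exists l; apply is_CInt_pos_iff; intros e He.
  assert (H : filter_prod (at_right 0) (Rbar_locally p_infty)
    (fun ab => Cmod (CInt g (fst ab) (snd ab) - l) < e)).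
  { apply (Hl (fun y => Cmod (y - l) < e)).
    apply (proj2 (locally_Cmod l _)); exists e; auto. }
  apply (filter_prod_pos (fun a b => Cmod (CInt g a b - l) < e)) in H.
  destruct H as (d & B & Hd & H); exists d, (Rmax B d); split; [exact Hd|].
  intros a b Ha Hb.
  assert (B1 := Rmax_l B d); assert (B2 := Rmax_r B d).
  exists (CInt g a b); split; [|apply H; lra].
  apply is_CInt_cont; [lra|]; intros t Ht; apply Hcont; lra.
Qed.

(** The bound depends on [g] only through [M], hence is uniform over families
    of integrands; exchanging limits relies on this. *)
Lemma dominated_tail l a b : is_CInt_pos g l -> 0 < a -> a <= b ->
  Cmod (l - CInt g a b) <= M * (dom_cdf alpha a + (1 - dom_cdf alpha b)).
Proof.
rewrite is_CInt_pos_iff; intros H Ha Hab.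
apply le_epsilon; intros e He.
destruct (H e He) as (d & B & Hd & Hl).
destruct (Hl (Rmin (d / 2) a) (Rmax (B + 1) b)) as (y & Hy & Hy').
{ split; [apply Rmin_pos; lra | eapply Rle_lt_trans; [apply Rmin_l | lra]]. }
{ eapply Rlt_le_trans; [|apply Rmax_l]; lra. }
apply CInt_unique in Hy; subst y.
replace (l - CInt g a b)%C with
  ((CInt g (Rmin (d / 2) a) (Rmax (B + 1) b) - CInt g a b)
   + - (CInt g (Rmin (d / 2) a) (Rmax (B + 1) b) - l))%C by ring.
eapply Rle_trans; [apply Cmod_triangle|]; rewrite Cmod_opp.
apply Rplus_le_compat; [|lra].
apply dominated_nested; [apply Rmin_pos; lra | apply Rmin_r | exact Hab | apply Rmax_r].
Qed.

Lemma dominated_bound l : is_CInt_pos g l -> Cmod l <= M.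
Proof.
intros H.
assert (H1 := dominated_tail l 1 1 H Rlt_0_1 (Rle_refl 1)).
assert (H2 := dominated_segment 1 1 Rlt_0_1 (Rle_refl 1)).
assert (H3 := Cmod_tri_minus l (CInt g 1 1)); lra.
Qed.

End Dominated.

Lemma dominated_weight alpha (u : R -> R) n K : -1 < alpha ->
  (forall x, 0 < x -> continuous u x) ->
  (forall x, 0 < x -> Rabs (u x) * (1 + x) ^ n <= K * dom_density alpha x) ->
  forall (h : R -> C) m, 0 <= m -> (forall x, 0 < x -> ccont h x) ->
  (forall x, 0 < x -> Cmod (h x) <= m * (1 + x) ^ n) ->
  (exists l, is_CInt_pos (fun x => RtoC (u x) * h x)%C l) /\
  (forall l, is_CInt_pos (fun x => RtoC (u x) * h x)%C l -> Cmod l <= m * K).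
Proof.
intros Ha Cu HD h m Hm Ch Hb.
assert (Cuh : forall x, 0 < x -> ccont (fun x => RtoC (u x) * h x)%C x).
{ intros x Hx; apply ccont_mult; [apply ccont_RtoC; now apply Cu | now apply Ch]. }
assert (Duh : forall x, 0 < x ->
  Cmod (RtoC (u x) * h x) <= m * K * dom_density alpha x).
{ intros x Hx; rewrite Cmod_mult, Cmod_R.
  specialize (HD x Hx); specialize (Hb x Hx).
  apply Rle_trans with (Rabs (u x) * (m * (1 + x) ^ n)).
  + apply Rmult_le_compat_l; [apply Rabs_pos | exact Hb].
  + rewrite Rmult_assoc; nra. }
split.
- apply (dominated_ex alpha Ha _ (m * K)); assumption.
- intros l; apply (dominated_bound alpha Ha _ (m * K)); assumption.
Qed.

(** From [y / (n + 1) <= exp (y / (n + 1))], raised to the power [n]. *)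
Lemma pow_le_exp (n : nat) : exists Cn, 0 < Cn /\ forall y, 0 <= y -> y ^ n <= Cn * exp y.
Proof.
exists (INR (S n) ^ n).
assert (Hn := lt_0_INR (S n) (Nat.lt_0_succ n)).
split; [now apply pow_lt|]; intros y Hy.
assert (H1 : y / INR (S n) <= exp (y / INR (S n))).
{ assert (Q := exp_ineq1_le (y / INR (S n))); lra. }
assert (H0 : 0 <= y / INR (S n)) by (apply Rdiv_le_0_compat; lra).
assert (H2 := pow_incr _ _ n (conj H0 H1)).
assert (H3 : exp (y / INR (S n)) ^ n <= exp y).
{ rewrite <- Rpower_pow by apply exp_pos; unfold Rpower; rewrite ln_exp.
  assert (E : INR n * (y / INR (S n)) <= y).
  { rewrite S_INR in *; apply Rle_trans with ((INR n + 1) * (y / (INR n + 1))); [nra|].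
    apply Req_le; field; apply Rgt_not_eq; exact Hn. }
  destruct E as [E|E]; [left; now apply exp_increasing | rewrite E; lra]. }
unfold Rdiv in H2; rewrite Rpow_mult_distr, pow_inv in H2.
assert (Hp := pow_lt _ n Hn).
apply Rmult_le_reg_l with (/ INR (S n) ^ n); [now apply Rinv_0_lt_compat|].
rewrite <- Rmult_assoc, Rinv_l, Rmult_1_l by lra.
fold (y / INR (S n)) in *; unfold Rdiv in *; lra.
Qed.

Lemma weight_dominated alpha N : - 1 < alpha ->
  exists K, 0 < K /\ forall x, 0 < x ->
    Laguerre_weight alpha x * (1 + x) ^ N <= K * dom_density alpha x.
Proof.
intros Ha.
destruct (INR_unbounded (alpha + 1)) as [m Hm].
destruct (pow_le_exp (N + 1 + m)) as (Cn & HCn & Hexp).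
exists (Cn * exp 1 / (alpha + 1)); split.
{ apply Rdiv_lt_0_compat; [apply Rmult_lt_0_compat; [exact HCn | apply exp_pos] | lra]. }
intros x Hx; unfold Laguerre_weight, dom_density, dom_cdf.
set (E := exp ((alpha + 1) * ln (1 + x))).
assert (HE : 0 < E) by apply exp_pos.
assert (Hl : 0 < ln (1 + x)) by (rewrite <- ln_1; apply ln_increasing; lra).
assert (HEm : E <= (1 + x) ^ m).
{ rewrite <- Rpower_pow by lra; unfold Rpower, E.
  apply Rlt_le, exp_increasing, Rmult_lt_compat_r; lra. }
replace (exp ((alpha + 1) * (ln x - ln (1 + x)))) with (Rpower x alpha * x / E).
2:{ unfold E, Rdiv, Rpower; rewrite <- exp_Ropp.
    rewrite <- (exp_ln x) at 2 by exact Hx.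
    rewrite <- !exp_plus; f_equal; ring. }
specialize (Hexp (1 + x) ltac:(lra)).
rewrite exp_plus in Hexp.
set (W := Rpower x alpha) in *.
assert (HW : 0 < W) by apply exp_pos.
replace (Cn * exp 1 / (alpha + 1) * ((alpha + 1) * (/ x - / (1 + x)) * (W * x / E)))
  with (W * (Cn * exp 1 / (E * (1 + x)))) by (field; lra).
rewrite Rmult_assoc; apply Rmult_le_compat_l; [lra|].
apply (proj1 (Rle_div_r _ _ _ (Rmult_lt_0_compat _ _ HE (Rplus_lt_0_compat _ _ Rlt_0_1 Hx)))).
rewrite exp_Ropp.
apply Rmult_le_reg_r with (exp x); [apply exp_pos|].
replace (/ exp x * (1 + x) ^ N * (E * (1 + x)) * exp x) with (E * ((1 + x) ^ N * (1 + x)))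
  by (field; apply Rgt_not_eq, exp_pos).
rewrite !pow_add, pow_1 in Hexp.
rewrite Rmult_assoc; eapply Rle_trans; [|exact Hexp].
rewrite Rmult_comm; apply Rmult_le_compat_l; [|exact HEm].
apply Rmult_le_pos; [apply pow_le|]; lra.
Qed.

(** * Moments of the Laguerre weight and orthogonality *)

Lemma weight_pos alpha x : 0 < Laguerre_weight alpha x.
Proof. apply Rmult_lt_0_compat; apply exp_pos. Qed.

Lemma weight_cont alpha x : 0 < x -> continuous (Laguerre_weight alpha) x.
Proof.
intros Hx; apply (ex_derive_continuous (K := R_AbsRing) (V := R_NormedModule)).
unfold Laguerre_weight, Rpower; auto_derive; exact Hx.
Qed.

Lemma pow_le_one_plus x n m : 0 <= x -> (n <= m)%nat -> x ^ n <= (1 + x) ^ m.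
Proof.
intros Hx Hnm; apply Rle_trans with ((1 + x) ^ n).
- apply pow_incr; lra.
- apply Rle_pow; [lra | exact Hnm].
Qed.

Lemma weight_moment_ex alpha n : -1 < alpha ->
  exists l, is_CInt_pos (fun x => RtoC (Laguerre_weight alpha x) * RtoC (x ^ n))%C l.
Proof.
intros Ha; destruct (weight_dominated alpha n Ha) as (K & _ & HD).
apply (dominated_weight alpha _ n K Ha (weight_cont alpha)) with (m := 1).
- intros x Hx; rewrite Rabs_right by apply Rgt_ge, weight_pos; now apply HD.
- lra.
- intros x _; apply ccont_RtoC.
  apply (ex_derive_continuous (K := R_AbsRing) (V := R_NormedModule)); auto_derive; trivial.
- intros x Hx; rewrite Cmod_R, Rabs_right, Rmult_1_l by (apply Rle_ge, pow_le; lra).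
  apply pow_le_one_plus; [lra | apply Nat.le_refl].
Qed.

(** Integration by parts: [x ^ (alpha + n + 1) exp (- x)] vanishes at both ends,
    being at most a constant times [dom_cdf alpha x / (1 + x)]. *)
Lemma weight_moment_succ alpha n (l : C) : -1 < alpha ->
  is_CInt_pos (fun x => RtoC (Laguerre_weight alpha x) * RtoC (x ^ n))%C l ->
  is_CInt_pos (fun x => RtoC (Laguerre_weight alpha x) * RtoC (x ^ S n))%C
    (RtoC (alpha + 1 + INR n) * l)%C.
Proof.
intros Ha Hl.
set (h := fun x => Laguerre_weight alpha x * x ^ S n).
set (dh := fun x => (alpha + 1 + INR n) * (Laguerre_weight alpha x * x ^ n) - h x).
assert (Hdh : forall x, 0 < x -> is_derive h x (dh x)).
{ intros x Hx; unfold h, dh, h, Laguerre_weight, Rpower.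
  auto_derive; [exact Hx|].
  replace (match n with 0%nat => 1 | S _ => INR n + 1 end) with (INR n + 1)
    by (destruct n; simpl; lra).
  simpl; field; lra. }
assert (Z : is_CInt_pos (fun x => RtoC (dh x)) (RtoC 0)).
{ destruct (weight_dominated alpha (S n) Ha) as (K & HK & HD).
  assert (Hh : forall x, 0 < x -> 0 <= h x <= K * (alpha + 1) * dom_cdf alpha x * / (1 + x)).
  { intros x Hx; unfold h; split.
    - apply Rmult_le_pos; [apply Rlt_le, weight_pos | apply pow_le; lra].
    - specialize (HD x Hx); unfold dom_density in HD.
      assert (Hp := pow_le_one_plus x n n ltac:(lra) (Nat.le_refl n)).
      assert (W := weight_pos alpha x).
      apply Rle_trans with (Laguerre_weight alpha x * (1 + x) ^ S n * (x / (1 + x))).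
      + replace (Laguerre_weight alpha x * (1 + x) ^ S n * (x / (1 + x)))
          with (Laguerre_weight alpha x * (x * (1 + x) ^ n)) by (simpl; field; lra).
        simpl; apply Rmult_le_compat_l; nra.
      + apply Rle_trans with (K * ((alpha + 1) * (/ x - / (1 + x)) * dom_cdf alpha x)
          * (x / (1 + x))).
        * apply Rmult_le_compat_r; [|exact HD]; apply Rdiv_le_0_compat; lra.
        * assert (C0 := dom_cdf_pos alpha x).
          replace (K * ((alpha + 1) * (/ x - / (1 + x)) * dom_cdf alpha x) * (x / (1 + x)))
            with (K * (alpha + 1) * dom_cdf alpha x * / (1 + x) * / (1 + x)) by (field; lra).
          assert (I : 0 < / (1 + x) <= 1).
          { split; [apply Rinv_0_lt_compat; lra|].
            rewrite <- Rinv_1; apply Rinv_le_contravar; lra. }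
          assert (Q : 0 <= K * (alpha + 1) * dom_cdf alpha x * / (1 + x)).
          { repeat apply Rmult_le_pos; lra. }
          nra. }
  apply is_CInt_pos_iff; intros e He.
  assert (HKa : 0 < K * (alpha + 1)) by (apply Rmult_lt_0_compat; lra).
  destruct (dom_cdf_near0 alpha Ha (e / 2 / (K * (alpha + 1)))) as (d & Hd & H0).
  { apply Rdiv_lt_0_compat; lra. }
  exists d, (Rmax d (2 * (K * (alpha + 1)) / e)); split; [exact Hd|]; intros a b Hab Hb.
  assert (B1 := Rmax_l d (2 * (K * (alpha + 1)) / e)).
  assert (B2 := Rmax_r d (2 * (K * (alpha + 1)) / e)).
  exists (RtoC (h b - h a)); split.
  - apply is_CInt_RtoC, (is_RInt_derive h dh);
    rewrite Rmin_left, Rmax_right by lra; intros x Hx; [apply Hdh; lra|].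
    apply (continuous_minus (V := R_NormedModule)
      (fun x => (alpha + 1 + INR n) * (Laguerre_weight alpha x * x ^ n)) h).
    + apply (continuous_scal_r (V := R_NormedModule) (alpha + 1 + INR n)
        (fun x => Laguerre_weight alpha x * x ^ n)).
      apply (continuous_mult (K := R_AbsRing)); [apply weight_cont; lra|].
      apply (ex_derive_continuous (K := R_AbsRing) (V := R_NormedModule)); auto_derive; trivial.
    + apply (ex_derive_continuous (K := R_AbsRing) (V := R_NormedModule)).
      exists (dh x); apply Hdh; lra.
  - replace (RtoC (h b - h a) - 0)%C with (RtoC (h b - h a)) by ring.
    rewrite Cmod_R.
    assert (Ha' := Hh a ltac:(lra)); assert (Hb' := Hh b ltac:(lra)).
    assert (U1 : h a < e / 2).
    { specialize (H0 a Hab); apply Rlt_div_r in H0; [|exact HKa].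
      assert (I : 0 < / (1 + a) <= 1).
      { split; [apply Rinv_0_lt_compat; lra|].
        rewrite <- Rinv_1; apply Rinv_le_contravar; lra. }
      assert (C0 := dom_cdf_pos alpha a).
      assert (Q : 0 < K * (alpha + 1) * dom_cdf alpha a) by (apply Rmult_lt_0_compat; lra).
      nra. }
    assert (U2 : h b < e / 2).
    { assert (C1 := dom_cdf_le1 alpha Ha b ltac:(lra)).
      assert (I : 0 < / (1 + b)) by (apply Rinv_0_lt_compat; lra).
      apply Rle_lt_trans with (K * (alpha + 1) * / (1 + b)).
      { apply Rle_trans with (1 := proj2 Hb'); apply Rmult_le_compat_r; [lra|].
        rewrite <- (Rmult_1_r (K * (alpha + 1))) at 2; apply Rmult_le_compat_l; lra. }
      apply Rmult_lt_reg_r with (1 + b); [lra|].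
      rewrite Rmult_assoc, Rinv_l, Rmult_1_r by lra.
      assert (B3 : 2 * (K * (alpha + 1)) / e < b) by lra.
      apply Rlt_div_l in B3; [|exact He]; nra. }
    apply Rabs_lt_between; lra. }
assert (Z2 := is_CInt_pos_minus _ _ _ _
  (is_CInt_pos_scal _ _ (RtoC (alpha + 1 + INR n)) Hl) Z).
replace (RtoC (alpha + 1 + INR n) * l - 0)%C
  with (RtoC (alpha + 1 + INR n) * l)%C in Z2 by ring.
revert Z2; apply is_CInt_pos_ext; intros x _; unfold dh, h.
rewrite <- !RtoC_mult, <- RtoC_minus; f_equal; ring.
Qed.

Lemma weight_moment alpha (m0 : C) : -1 < alpha ->
  is_CInt_pos (fun x => RtoC (Laguerre_weight alpha x) * RtoC (x ^ 0))%C m0 ->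
  forall n, is_CInt_pos (fun x => RtoC (Laguerre_weight alpha x) * RtoC (x ^ n))%C
    (RtoC (pochhammer (alpha + 1) n) * m0)%C.
Proof.
intros Ha H0; induction n.
- replace (RtoC (pochhammer (alpha + 1) 0) * m0)%C with m0 by (simpl; ring); exact H0.
- simpl pochhammer.
  replace (RtoC (pochhammer (alpha + 1) n * (alpha + 1 + INR n)) * m0)%C
    with (RtoC (alpha + 1 + INR n) * (RtoC (pochhammer (alpha + 1) n) * m0))%C
    by (rewrite RtoC_mult; ring).
  now apply weight_moment_succ.
Qed.

Lemma pochhammer_pos z n : 0 < z -> 0 < pochhammer z n.
Proof.
intros Hz; induction n; simpl; [lra|].
apply Rmult_lt_0_compat; [exact IHn|]; assert (Q := pos_INR n); lra.
Qed.

Lemma pochhammer_shift z n : pochhammer z (S n) = z * pochhammer (z + 1) n.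
Proof.
induction n; [simpl; ring|].
change (pochhammer z (S (S n))) with (pochhammer z (S n) * (z + INR (S n))).
rewrite IHn, S_INR; simpl; ring.
Qed.

Lemma pochhammer_add z n m :
  pochhammer z (n + m) = pochhammer z n * pochhammer (z + INR n) m.
Proof.
induction m; [rewrite Nat.add_0_r; simpl; ring|].
rewrite Nat.add_succ_r; simpl; rewrite IHm, plus_INR; ring.
Qed.

Lemma pochhammer_diff z n :
  pochhammer (z + 1) (S n) - pochhammer z (S n) = INR (S n) * pochhammer (z + 1) n.
Proof.
rewrite (pochhammer_shift z n), S_INR; simpl; ring.
Qed.

(** Up to sign, the binomial coefficient [C k i]. *)
Definition diff_coef (k i : nat) : R := pochhammer (- INR k) i / INR (fact i).

Lemma diff_coef_vanish k : diff_coef k (S k) = 0.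
Proof.
unfold diff_coef; simpl pochhammer; unfold Rdiv.
replace (- INR k + INR k) with 0 by ring; ring.
Qed.

Lemma diff_coef_succ k i : diff_coef (S k) (S i) = diff_coef k (S i) - diff_coef k i.
Proof.
unfold diff_coef; rewrite (pochhammer_shift (- INR (S k))).
replace (- INR (S k) + 1) with (- INR k) by (rewrite S_INR; ring).
rewrite fact_simpl, mult_INR, !S_INR; simpl pochhammer.
assert (F := INR_fact_neq_0 i); assert (Q := pos_INR i).
field; lra.
Qed.

(** Summation by parts, from Pascal's rule [diff_coef_succ]: a difference of
    order [k + 1] is a difference of order [k] of first differences. *)
Lemma diff_coef_sum k (g : nat -> R) :
  sum_f_R0 (fun i => diff_coef (S k) i * g i) (S k) =
  sum_f_R0 (fun i => diff_coef k i * (g i - g (S i))) k.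
Proof.
rewrite decomp_sum by apply Nat.lt_0_succ; simpl Nat.pred.
rewrite (sum_eq (fun i => diff_coef (S k) (S i) * g (S i))
  (fun i => diff_coef k (S i) * g (S i) - diff_coef k i * g (S i)))
  by (intros i _; rewrite diff_coef_succ; ring).
rewrite minus_sum.
assert (E := decomp_sum (fun i => diff_coef k i * g i) (S k) (Nat.lt_0_succ k)).
simpl Nat.pred in E; rewrite tech5, diff_coef_vanish, Rmult_0_l, Rplus_0_r in E.
replace (diff_coef (S k) 0) with (diff_coef k 0) by (unfold diff_coef; simpl; reflexivity).
cbv beta in E; rewrite (sum_eq (fun i => diff_coef k i * (g i - g (S i)))
  (fun i => diff_coef k i * g i - diff_coef k i * g (S i))) by (intros i _; ring).
rewrite minus_sum; lra.
Qed.

(** [pochhammer (z + i) j] is a polynomial of degree [j] in [i], annihilated by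
    differences of order [k > j]. *)
Lemma diff_pochhammer k : forall j z, (j < k)%nat ->
  sum_f_R0 (fun i => diff_coef k i * pochhammer (z + INR i) j) k = 0.
Proof.
induction k; intros j z Hj; [lia|].
rewrite (diff_coef_sum k (fun i => pochhammer (z + INR i) j)).
destruct j as [|j].
- rewrite (sum_eq _ (fun _ => 0)) by (intros i _; simpl; ring).
  rewrite sum_cte; ring.
- rewrite (sum_eq _ (fun i => diff_coef k i * pochhammer (z + 1 + INR i) j * - INR (S j))).
  { rewrite <- scal_sum, IHk by lia; ring. }
  intros i _.
  assert (E := pochhammer_diff (z + INR i) j).
  replace (z + INR (S i)) with (z + INR i + 1) by (rewrite S_INR; ring).
  replace (z + 1 + INR i) with (z + INR i + 1) by ring.
  replace (pochhammer (z + INR i) (S j) - pochhammer (z + INR i + 1) (S j))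
    with (- (INR (S j) * pochhammer (z + INR i + 1) j)) by lra.
  ring.
Qed.

Lemma is_CInt_pos_sum (p : nat -> R -> R) (l : nat -> R) (m : C) n :
  (forall i, is_CInt_pos (fun x => RtoC (p i x)) (RtoC (l i) * m)%C) ->
  is_CInt_pos (fun x => RtoC (sum_f_R0 (fun i => p i x) n)) (RtoC (sum_f_R0 l n) * m)%C.
Proof.
intros H; induction n; [apply H|]; simpl.
rewrite RtoC_plus, Cmult_plus_distr_r.
apply (is_CInt_pos_ext
  (fun x => RtoC (sum_f_R0 (fun i => p i x) n) + RtoC (p (S n) x))%C).
- intros x _; now rewrite <- RtoC_plus.
- apply is_CInt_pos_plus; [exact IHn | apply H].
Qed.

(** By the moments, the integral is a multiple of the [k]-th difference of
    [i |-> pochhammer (alpha + 1 + i) j]. *)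
Lemma Laguerre_orthogonal alpha k j : -1 < alpha -> (j < k)%nat ->
  is_CInt_pos
    (fun x => RtoC (Laguerre_weight alpha x * Laguerre alpha k x) * RtoC (x ^ j))%C
    (RtoC 0).
Proof.
intros Ha Hj.
destruct (weight_moment_ex alpha 0 Ha) as [m0 Hm0]; change C in m0.
set (u := pochhammer (alpha + 1) k / INR (fact k)).
set (cf := fun i => diff_coef k i * / pochhammer (alpha + 1) i * u).
assert (H : is_CInt_pos (fun x => RtoC (sum_f_R0 (fun i =>
    cf i * (Laguerre_weight alpha x * x ^ (i + j))) k))
  (RtoC (sum_f_R0 (fun i => cf i * pochhammer (alpha + 1) (i + j)) k)%R * m0)%C).
{ apply is_CInt_pos_sum; intros i.
  apply (is_CInt_pos_ext
    (fun x => RtoC (cf i) * (RtoC (Laguerre_weight alpha x) * RtoC (x ^ (i + j))))%C).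
  { intros x _; now rewrite !RtoC_mult. }
  rewrite RtoC_mult, <- Cmult_assoc.
  apply is_CInt_pos_scal; now apply weight_moment. }
replace (sum_f_R0 (fun i => cf i * pochhammer (alpha + 1) (i + j)) k) with 0 in H.
2:{ rewrite (sum_eq _ (fun i => diff_coef k i * pochhammer (alpha + 1 + INR i) j * u)).
    { rewrite <- scal_sum, diff_pochhammer by exact Hj; ring. }
    intros i _; unfold cf; rewrite pochhammer_add.
    assert (P := pochhammer_pos (alpha + 1) i ltac:(lra)); field; lra. }
replace (RtoC 0 * m0)%C with (RtoC 0) in H by ring.
revert H; apply is_CInt_pos_ext; intros x _.
rewrite <- RtoC_mult; f_equal; unfold Laguerre; fold u.
set (S := sum_f_R0 (fun i => pochhammer (- INR k) i / pochhammer (alpha + 1) i *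
  (x ^ i / INR (fact i))) k).
replace (Laguerre_weight alpha x * (u * S) * x ^ j)
  with ((Laguerre_weight alpha x * u * x ^ j) * S) by ring.
unfold S; rewrite scal_sum; apply sum_eq; intros i _.
unfold cf, diff_coef, Rdiv; rewrite pow_add; ring.
Qed.

Lemma sum_pow_bound (a : nat -> R) n :
  exists K, 0 <= K /\ forall x, 0 <= x ->
    Rabs (sum_f_R0 (fun i => a i * (x ^ i / INR (fact i))) n) <= K * (1 + x) ^ n.
Proof.
induction n as [|n (K & HK & IH)].
- exists (Rabs (a O)); split; [apply Rabs_pos|]; intros x _; simpl.
  apply Req_le; rewrite Rmult_1_r; f_equal; field.
- exists (K + Rabs (a (S n))); split; [assert (Q := Rabs_pos (a (S n))); lra|].
  intros x Hx; rewrite tech5; eapply Rle_trans; [apply Rabs_triang|].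
  rewrite Rmult_plus_distr_r; apply Rplus_le_compat.
  + eapply Rle_trans; [now apply IH|]; apply Rmult_le_compat_l; [exact HK|].
    apply Rle_pow; [lra | lia].
  + rewrite Rabs_mult; apply Rmult_le_compat_l; [apply Rabs_pos|].
    rewrite Rabs_right.
    * apply Rle_trans with (x ^ S n); [|apply pow_le_one_plus; trivial].
      assert (F := INR_fact_lt_0 (S n)).
      assert (F1 : 1 <= INR (fact (S n))).
      { apply (le_INR 1), lt_O_fact. }
      apply Rle_div_l; [exact F|].
      assert (P := pow_le x (S n) Hx); nra.
    * apply Rle_ge, Rdiv_le_0_compat; [now apply pow_le | apply INR_fact_lt_0].
Qed.

Lemma Laguerre_bound alpha k :
  exists K, 0 <= K /\ forall x, 0 <= x -> Rabs (Laguerre alpha k x) <= K * (1 + x) ^ k.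
Proof.
destruct (sum_pow_bound (fun j => pochhammer (- INR k) j / pochhammer (alpha + 1) j) k)
  as (K & HK & H).
exists (Rabs (pochhammer (alpha + 1) k / INR (fact k)) * K); split.
{ apply Rmult_le_pos; [apply Rabs_pos | exact HK]. }
intros x Hx; unfold Laguerre; rewrite Rabs_mult, Rmult_assoc.
apply Rmult_le_compat_l; [apply Rabs_pos | now apply H].
Qed.

Lemma Laguerre_cont alpha k x : continuous (Laguerre alpha k) x.
Proof.
apply (continuous_scal_r (V := R_NormedModule) (pochhammer (alpha + 1) k / INR (fact k))
  (fun x => sum_f_R0 (fun j => pochhammer (- INR k) j / pochhammer (alpha + 1) j *
                     (x ^ j / INR (fact j))) k)).
set (p := fun i x => pochhammer (- INR k) i / pochhammer (alpha + 1) i *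
  (x ^ i / INR (fact i))).
assert (T : forall i, continuous (p i) x).
{ intros i; apply (ex_derive_continuous (K := R_AbsRing) (V := R_NormedModule)).
  unfold p; auto_derive; trivial. }
assert (G : forall n, continuous (fun x => sum_f_R0 (fun j => p j x) n) x).
{ induction n; [apply T|].
  apply (continuous_plus (V := R_NormedModule) (fun x => sum_f_R0 (fun j => p j x) n));
  [exact IHn | apply (T (S n))]. }
apply G.
Qed.

(** * The parabola and its interior in the coordinate [w], [z = - w ^ 2] *)

(** The square roots of [w ^ 2] are [w] and [- w], and [Csqrt] picks the one with
    nonnegative real part. *)
Lemma Re_Csqrt_sqr (w : C) : Re (Csqrt (w ^ 2)) = Rabs (Re w).
Proof.
set (u := Csqrt (w ^ 2)).
assert (E : ((u - w) * (u + w) = 0)%C).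
{ assert (H := Csqrt_sqr (w ^ 2)); fold u in H.
  transitivity (u ^ 2 - w ^ 2)%C; [ring | rewrite H; ring]. }
assert (Hr : 0 <= Re u) by apply Csqrt_re_ge0.
clearbody u; unfold Re in *.
destruct (Ceq_dec (u - w) 0) as [E1|E1].
- apply (f_equal fst) in E1; cbn in E1; rewrite Rabs_right; lra.
- destruct (Ceq_dec (u + w) 0) as [E2|E2]; [|now destruct (Cmult_neq_0 _ _ E1 E2)].
  apply (f_equal fst) in E2; cbn in E2; rewrite Rabs_left1; lra.
Qed.

Lemma Cdiff_neg_sqr w : Cdiff (fun v => - v ^ 2)%C w.
Proof.
apply Cdiff_opp, Cdiff_mult; [apply Cdiff_id|].
apply Cdiff_mult; [apply Cdiff_id | apply Cdiff_const].
Qed.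

Lemma strip_in rho (w : C) : Rabs (Re w) < rho -> in_parabola rho (- w ^ 2)%C.
Proof.
intros H; unfold in_parabola.
replace (- - w ^ 2)%C with (w ^ 2)%C by ring; now rewrite Re_Csqrt_sqr.
Qed.

Lemma strip_Cdiff rho f (w : C) :
  analytic_within_and_on_parabola rho f -> Rabs (Re w) <= rho ->
  Cdiff (fun v => f (- v ^ 2)%C) w.
Proof.
intros (U & _ & HU & Hf) Hw.
apply (Cdiff_comp f (fun v => - v ^ 2)%C); [apply Cdiff_neg_sqr|].
apply Cdiff_ex_derive, Hf, HU.
unfold in_parabola, on_parabola.
replace (- - w ^ 2)%C with (w ^ 2)%C by ring; rewrite Re_Csqrt_sqr; lra.
Qed.

(** The parabola stays at distance at least [rho ^ 2] from the half-line:
    [z - x] factors as [- (w + i sqrt x) (w - i sqrt x)] and both factors have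
    real part [rho]. *)
Lemma parabola_dist rho t x : 0 < rho -> 0 < x ->
  rho ^ 2 <= Cmod (parabola rho t - RtoC x).
Proof.
intros Hr Hx.
assert (E : (parabola rho t - RtoC x =
  - ((rho, (t + sqrt x)%R) * (rho, (t - sqrt x)%R)))%C).
{ assert (S := sqrt_sqrt x (Rlt_le _ _ Hx)).
  unfold parabola, Cminus, Cplus, Copp, Cpow, Cmult, RtoC; simpl; f_equal; nra. }
rewrite E, Cmod_opp, Cmod_mult.
assert (B : forall u, rho <= Cmod (rho, u)).
{ intros u; assert (Q := re_le_Cmod (rho, u)); simpl in Q.
  rewrite Rabs_right in Q; lra. }
assert (B1 := B (t + sqrt x)); assert (B2 := B (t - sqrt x)).
simpl; rewrite Rmult_1_r; apply Rmult_le_compat; lra.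
Qed.

Lemma parabola_minus_neq0 rho t x : 0 < rho -> 0 < x ->
  (parabola rho t - RtoC x)%C <> 0.
Proof.
intros Hr Hx E; assert (H := parabola_dist rho t x Hr Hx).
rewrite E, Cmod_0 in H; nra.
Qed.

(** * The truncated contour integral against the Cauchy kernel *)

Definition kernel_int (rho : R) (f : C -> C) (T x : R) : C :=
  CInt (fun t => f (parabola rho t) * parabola' rho t / (parabola rho t - RtoC x))%C
    (- T) T.

(** The image under [z = - w ^ 2] of the segment [Im w = T], which closes the
    truncated parabola. *)
Definition cap_int (rho : R) (h : C -> C) (T : R) : C :=
  CInt (fun s => h (- (s, T) ^ 2) * (- (2 * (s, T))))%C (- rho) rho.

Lemma is_CInt_odd g a :
  0 <= a -> (forall s, - a <= s <= a -> ccont g s) ->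
  (forall s, - a < s < a -> g (- s) = (- g s)%C) -> CInt g (- a) a = 0.
Proof.
intros Ha Hc Ho.
assert (H : is_CInt g (- a) a (CInt g (- a) a)) by (apply is_CInt_cont; [lra | exact Hc]).
assert (H1 : is_CInt (fun s => g (- s)) (- a) a (CInt g (- a) a)).
{ apply is_CInt_reflect; now rewrite Ropp_involutive. }
assert (H2 : is_CInt (fun s => g (- s)) (- a) a (- (1) * CInt g (- a) a)%C).
{ apply is_CInt_ext with (fun s => - (1) * g s)%C; [lra| |now apply is_CInt_scal].
  intros s Hs; rewrite Ho by exact Hs; cring. }
apply CInt_unique in H1; apply CInt_unique in H2; rewrite H1 in H2.
set (I := CInt g (- a) a) in *.
assert (E : (2 * I = 0)%C).
{ transitivity (I + I)%C; [ring|]; rewrite H2 at 1; ring. }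
destruct (Ceq_dec I 0) as [Z|Z]; [exact Z|].
exfalso; apply (Cmult_neq_0 2 I); trivial.
intros Z2; apply (f_equal fst) in Z2; simpl in Z2; lra.
Qed.

(** Cauchy's formula on the upper half [0 <= Im w <= T] of the strip for
    [G w = 2 w f (- w ^ 2) / (w ^ 2 + x)], whose only pole there is [i sqrt x].
    As [G] is odd, the bottom edge contributes nothing and the left edge
    continues the right edge down to [Im w = - T]; the top edge is [cap_int]. *)
Lemma kernel_int_residue rho f T x :
  0 < rho -> analytic_within_and_on_parabola rho f -> 0 < T -> 0 < x < T ^ 2 ->
  kernel_int rho f T x =
  (2 * RtoC PI * Ci * f (RtoC x)
   + cap_int rho (fun z => f z / (z - RtoC x)) T)%C.
Proof.
intros Hr Hf HT Hx.
set (r := sqrt x).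
assert (Hr0 : 0 < r) by (apply sqrt_lt_R0; lra).
assert (Hrr : r * r = x) by (apply sqrt_sqrt; lra).
assert (HrT : r < T) by nra.
set (p := (0, r) : C).
assert (Hp : (p * p = - RtoC x)%C)
  by (unfold p, RtoC, Copp, Cmult; simpl; f_equal; lra).
set (F := fun w => (2 * w * f (- w ^ 2) / (w + p))%C).
set (g := fun w => (F w / (w - p))%C).
assert (Np : forall w : C, 0 <= Im w -> (w + p)%C <> 0).
{ intros w Hw E; apply (f_equal snd) in E; simpl in E; unfold Im in Hw; lra. }
assert (N : forall s t, s <> 0 \/ (t <> r /\ t <> - r) ->
  (((s, t) : C) + p)%C <> 0 /\ (((s, t) : C) - p)%C <> 0).
{ intros s t H; split; intros E; assert (E1 := f_equal fst E);
  assert (E2 := f_equal snd E); simpl in E1, E2; lra. }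
assert (Dn : forall s t, - rho <= s <= rho ->
  Cdiff (fun w => 2 * w * f (- w ^ 2))%C ((s, t) : C)).
{ intros s t Hs; apply Cdiff_mult.
  - apply Cdiff_mult; [apply Cdiff_const | apply Cdiff_id].
  - apply (strip_Cdiff rho); [exact Hf|]; simpl; now apply Rabs_le. }
assert (DF : forall s t, - rho <= s <= rho -> (((s, t) : C) + p)%C <> 0 ->
  Cdiff F ((s, t) : C)).
{ intros s t Hs Hn; apply Cdiff_mult; [now apply Dn|].
  apply Cdiff_inv; [|exact Hn]; apply Cdiff_plus; [apply Cdiff_id | apply Cdiff_const]. }
assert (Cg : forall s t, - rho <= s <= rho -> s <> 0 \/ (t <> r /\ t <> - r) ->
  ccont g ((s, t) : C)).
{ intros s t Hs Hn; destruct (N s t Hn); apply ccont_div; trivial.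
  - now apply Cdiff_cont, DF.
  - apply ccont_minus; [apply ccont_id | apply ccont_const]. }
assert (Odd : forall s t, s <> 0 \/ (t <> r /\ t <> - r) -> g (- s, - t) = (- g (s, t))%C).
{ intros s t Hn; destruct (N s t Hn) as [N1 N2].
  assert (N3 : (- (s, t) + p)%C <> 0).
  { intros E; apply N2; transitivity (- (- (s, t) + p))%C; [ring | rewrite E; ring]. }
  assert (N4 : (- (s, t) - p)%C <> 0).
  { intros E; apply N1; transitivity (- (- (s, t) - p))%C; [ring | rewrite E; ring]. }
  change ((- s, - t) : C) with (- (s, t))%C; unfold g, F.
  replace (- (- (s, t)) ^ 2)%C with (- (s, t) ^ 2)%C by ring.
  field; repeat split; assumption. }
assert (Hc := Cauchy_rect F (- rho) rho 0 T 0 r ltac:(lra) ltac:(lra)).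
fold p in Hc; fold g in Hc.
assert (Hc' : rect_int g (- rho) rho 0 T = (2 * RtoC PI * Ci * F p)%C).
{ apply Hc; intros s t Hs Ht; apply DF; [exact Hs|]; now apply Np. }
clear Hc.
assert (EF : F p = f (RtoC x)).
{ unfold F; replace (- p ^ 2)%C with (RtoC x).
  2:{ transitivity (- (p * p))%C; [rewrite Hp|]; ring. }
  assert (p + p <> 0)%C by (apply Np; simpl; lra).
  field_simplify_eq; [ring | assumption]. }
rewrite EF in Hc'; unfold rect_int in Hc'.
rewrite (is_CInt_odd (fun s => g (s, 0))) in Hc'.
2: lra.
2:{ intros s Hs; apply ccont_horizontal, Cg; [exact Hs | right; lra]. }
2:{ intros s Hs; rewrite <- Odd by (right; lra); now rewrite Ropp_0. }
assert (Hside : is_CInt (fun t => g (- rho, t)) 0 T (- (1) * CInt (fun t => g (rho, t)) (- T) 0)%C).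
{ apply is_CInt_ext with (fun t => - (1) * g (rho, (- t)%R))%C; [lra| |].
  - intros t Ht.
    assert (O := Odd rho (- t) ltac:(left; lra)).
    rewrite Ropp_involutive in O; rewrite O; cring.
  - apply is_CInt_scal.
    apply (is_CInt_reflect (fun t => g (rho, t)) 0 T); rewrite Ropp_0.
    apply is_CInt_cont; [lra|]; intros t Ht; apply ccont_vertical, Cg; [|left]; lra. }
apply CInt_unique in Hside; rewrite Hside in Hc'; clear Hside.
assert (Hsplit : CInt (fun t => g (rho, t)) (- T) T =
  (CInt (fun t => g (rho, t)) (- T) 0 + CInt (fun t => g (rho, t)) 0 T)%C).
{ apply CInt_split; [|lra].
  intros t Ht; apply ccont_vertical, Cg; [|left]; lra. }
assert (EG : forall s t, s <> 0 \/ (t <> r /\ t <> - r) ->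
  g (s, t) = (f (- (s, t) ^ 2) / (- (s, t) ^ 2 - RtoC x) * (- (2 * (s, t))))%C).
{ intros s t Hn; destruct (N s t Hn) as [N1 N2].
  assert (Z : (- (s, t) ^ 2 - RtoC x = - (((s, t) + p) * ((s, t) - p)))%C).
  { transitivity (- (s, t) ^ 2 + p * p)%C; [rewrite Hp|]; ring. }
  unfold g, F; rewrite Z; field; repeat split; assumption. }
assert (Hk : kernel_int rho f T x = (Ci * CInt (fun t => g (rho, t)) (- T) T)%C).
{ apply CInt_unique.
  apply is_CInt_ext with (fun t => Ci * g (rho, t))%C; [lra| |].
  - intros t Ht; rewrite EG by (left; lra); unfold parabola, parabola'.
    assert (Nz := parabola_minus_neq0 rho t x Hr (proj1 Hx)); unfold parabola in Nz.
    cfield; exact Nz.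
  - apply is_CInt_scal, is_CInt_cont; [lra|].
    intros t Ht; apply ccont_vertical, Cg; [|left]; lra. }
assert (Hcap : cap_int rho (fun z => f z / (z - RtoC x))%C T
  = CInt (fun s => g (s, T)) (- rho) rho).
{ apply CInt_unique; apply is_CInt_ext with (fun s => g (s, T)); [lra| |].
  - intros s Hs; apply EG; right; lra.
  - apply is_CInt_cont; [lra|].
    intros s Hs; apply ccont_horizontal, Cg; [exact Hs | right; lra]. }
rewrite Hk, Hsplit, Hcap, <- Hc'; ring.
Qed.

(** * Growth in the strip and the size of the cap *)

Lemma Cmod_neg_sqr (s t : R) : Cmod (- (s, t) ^ 2)%C = s ^ 2 + t ^ 2.
Proof. rewrite Cmod_opp, Cmod_pow, Cmod2_alt; reflexivity. Qed.

(** [s ^ 2 + t ^ 2] lies between [t ^ 2] and [2 t ^ 2]; the constant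
    [2 ^ |beta|] serves both signs of [beta]. *)
Lemma Rpower_sum_sqr_le beta s t : Rabs s <= Rabs t -> 1 <= Rabs t ->
  Rpower (s ^ 2 + t ^ 2) beta <= exp (Rabs beta * ln 2) * Rpower (Rabs t) (2 * beta).
Proof.
intros Hs Ht.
rewrite <- (pow2_abs s), <- (pow2_abs t).
set (a := Rabs s) in *; set (b := Rabs t) in *.
assert (Ha : 0 <= a) by apply Rabs_pos.
unfold Rpower; rewrite <- exp_plus.
assert (E1 : ln (b ^ 2) <= ln (a ^ 2 + b ^ 2)) by (apply Rcomplements.ln_le; nra).
assert (E2 : ln (a ^ 2 + b ^ 2) <= ln 2 + ln (b ^ 2)).
{ rewrite <- ln_mult by nra; apply Rcomplements.ln_le; nra. }
assert (E3 : ln (b ^ 2) = 2 * ln b).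
{ simpl; rewrite Rmult_1_r, ln_mult by lra; ring. }
assert (A1 := Rle_abs beta); assert (A2 := Rle_abs (- beta)); rewrite Rabs_Ropp in A2.
assert (H : beta * ln (a ^ 2 + b ^ 2) <= Rabs beta * ln 2 + 2 * beta * ln b).
{ replace (ln (a ^ 2 + b ^ 2)) with ((ln (a ^ 2 + b ^ 2) - ln (b ^ 2)) + 2 * ln b) by lra.
  set (d := ln (a ^ 2 + b ^ 2) - ln (b ^ 2)) in *.
  assert (0 <= d <= ln 2) by (unfold d; lra).
  assert (Rabs beta * d <= Rabs beta * ln 2) by (apply Rmult_le_compat_l; [apply Rabs_pos|lra]).
  nra. }
destruct H as [H|H]; [left; now apply exp_increasing | rewrite H; lra].
Qed.

Section Growth.
Variables (rho beta K M : R) (f : C -> C).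
Hypothesis Hrho : 0 < rho.
Hypothesis Hf : analytic_within_and_on_parabola rho f.
Hypothesis HK : 0 < K.
Hypothesis Hgrow : forall z : C, in_parabola rho z -> M <= Cmod z ->
  Cmod (f z) <= K * Rpower (Cmod z) beta.

(** The bound is assumed in the open interior only and reaches the
    parabola by continuity, because the right-hand side obtained in the
    interior does not depend on [s]. *)
Lemma strip_growth : exists B T0, 0 < B /\ 1 <= T0 /\ rho <= T0 /\
  forall s t, Rabs s <= rho -> T0 <= Rabs t ->
    Cmod (f (- (s, t) ^ 2)%C) <= B * Rpower (Rabs t) (2 * beta).
Proof.
exists (K * exp (Rabs beta * ln 2)), (Rmax (Rmax 1 rho) M).
assert (Q1 := Rmax_l (Rmax 1 rho) M); assert (Q2 := Rmax_r (Rmax 1 rho) M).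
assert (Q3 := Rmax_l 1 rho); assert (Q4 := Rmax_r 1 rho).
split; [apply Rmult_lt_0_compat; [exact HK | apply exp_pos]|].
split; [lra|]; split; [lra|]; intros s t Hs Ht.
assert (In : forall s', Rabs s' < rho -> Cmod (f (- (s', t) ^ 2)%C) <=
  K * exp (Rabs beta * ln 2) * Rpower (Rabs t) (2 * beta)).
{ intros s' Hs'; eapply Rle_trans; [apply Hgrow|].
  - now apply strip_in.
  - rewrite Cmod_neg_sqr, <- (pow2_abs t); assert (Q := pow2_ge_0 s'); nra.
  - rewrite Cmod_neg_sqr, Rmult_assoc; apply Rmult_le_compat_l; [lra|].
    apply Rpower_sum_sqr_le; lra. }
apply le_epsilon; intros e He.
assert (Cc : ccont (fun s' : R => f (- (s', t) ^ 2)%C) s).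
{ apply (ccont_horizontal (fun w => f (- w ^ 2)%C)), Cdiff_cont.
  now apply strip_Cdiff with rho. }
destruct (ccont_near _ _ _ He Cc) as [d Hd].
(* [s] is approached by [s (1 - eta)], inside the open strip and at distance
   less than [d] from [s]. *)
set (eta := Rmin (1 / 2) (d / (2 * rho))).
assert (Hd0 := cond_pos d).
assert (Heta : 0 < eta).
{ unfold eta; apply Rmin_pos; [lra | apply Rdiv_lt_0_compat; lra]. }
assert (Heta1 : eta <= 1 / 2) by apply Rmin_l.
assert (Heta2 : eta * rho <= d / 2).
{ apply Rle_trans with (d / (2 * rho) * rho).
  - apply Rmult_le_compat_r; [lra | apply Rmin_r].
  - apply Req_le; field; lra. }
assert (As := Rabs_pos s).
specialize (Hd (s * (1 - eta))).
eapply Rle_trans; [apply (Cmod_tri_minus _ (f (- ((s * (1 - eta))%R, t) ^ 2)%C))|].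
apply Rplus_le_compat.
- apply In; rewrite Rabs_mult, (Rabs_right (1 - eta)) by lra; nra.
- rewrite Cmod_minus_sym; apply Rlt_le, Hd.
  unfold ball; simpl; unfold AbsRing_ball, abs, minus, plus, opp; simpl.
  replace (s * (1 - eta) + - s) with (- (s * eta)) by ring.
  rewrite Rabs_Ropp, Rabs_mult, (Rabs_right eta) by lra; nra.
Qed.

Lemma strip_poly_bound s : Rabs s <= rho ->
  exists B n, 0 < B /\ forall t, Cmod (f (- (s, t) ^ 2)%C) <= B * (1 + Rabs t) ^ n.
Proof.
intros Hs; destruct strip_growth as (B & T0 & HB & HT0 & _ & H).
destruct (INR_unbounded (2 * beta)) as [n Hn].
destruct (bounded_continuity (V := C_R_NormedModule)
  (fun t => f (- (s, t) ^ 2)%C) (- T0) T0) as [m Hm].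
{ intros t Ht.
  apply (ccont_vertical (fun w => f (- w ^ 2)%C)), Cdiff_cont.
  now apply strip_Cdiff with rho. }
assert (Hm' : forall t, Rabs t <= T0 -> Cmod (f (- (s, t) ^ 2)%C) <= Rabs m).
{ intros t Ht; apply Rabs_le_between in Ht.
  apply Rle_trans with m; [|apply Rle_abs].
  rewrite Cmod_norm; apply Rlt_le, Hm; lra. }
assert (Am := Rabs_pos m).
exists (B + Rabs m), n; split; [lra|]; intros t.
assert (P : 1 <= (1 + Rabs t) ^ n).
{ apply pow_R1_Rle; assert (Q := Rabs_pos t); lra. }
destruct (Rle_dec (Rabs t) T0) as [Ht|Ht].
- apply Rle_trans with (1 := Hm' t Ht); nra.
- apply Rle_trans with (B * (1 + Rabs t) ^ n); [|nra].
  apply Rle_trans with (1 := H s t Hs ltac:(lra)).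
  apply Rmult_le_compat_l; [lra|].
  apply Rle_trans with (Rpower (Rabs t) (INR n)); [apply Rle_Rpower; lra|].
  rewrite Rpower_pow by lra; apply pow_le_one_plus; [lra | apply Nat.le_refl].
Qed.

Lemma is_CInt_cap (D : C -> C) T :
  (forall z, ccont D z) -> (forall s, - rho <= s <= rho -> D (- (s, T) ^ 2)%C <> 0) ->
  is_CInt (fun s => f (- (s, T) ^ 2) / D (- (s, T) ^ 2) * (- (2 * (s, T))))%C (- rho) rho
    (cap_int rho (fun z => f z / D z)%C T).
Proof.
intros Dc D0; apply is_CInt_cont; [lra|]; intros s Hs.
apply (ccont_horizontal (fun w => f (- w ^ 2) / D (- w ^ 2) * (- (2 * w)))%C).
apply ccont_mult.
- apply ccont_div; [| |now apply D0].
  + apply Cdiff_cont, strip_Cdiff with rho; [exact Hf|]; now apply Rabs_le.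
  + apply (continuous_comp (fun w : C_UniformSpace => (- w ^ 2)%C : C_UniformSpace) D).
    * apply Cdiff_cont, Cdiff_neg_sqr.
    * apply Dc.
- apply ccont_opp, ccont_mult; [apply ccont_const | apply ccont_id].
Qed.

Lemma cap_int_bound (D : C -> C) T m :
  rho <= T ->
  (forall z, ccont D z) -> (forall s, - rho <= s <= rho -> D (- (s, T) ^ 2)%C <> 0) ->
  (forall s, - rho <= s <= rho -> Cmod (f (- (s, T) ^ 2) / D (- (s, T) ^ 2))%C <= m) ->
  Cmod (cap_int rho (fun z => f z / D z)%C T) <= 8 * rho * T * m.
Proof.
intros HT Dc D0 Hm.
apply Rle_trans with (m * (4 * T) * (rho - - rho)); [|apply Req_le; ring].
eapply is_CInt_norm_const; [lra | | now apply is_CInt_cap].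
intros s Hs; cbv beta; rewrite Cmod_mult.
assert (Cs := Cmod_ge_0 (f (- (s, T) ^ 2) / D (- (s, T) ^ 2))%C).
apply Rmult_le_compat; [exact Cs | apply Cmod_ge_0 | now apply Hm |].
rewrite Cmod_opp, Cmod_mult, Cmod_R, Rabs_right by lra.
assert (Q : Cmod (s, T) <= rho + T).
{ eapply Rle_trans; [apply Cmod_le_Rabs|]; simpl.
  apply Rplus_le_compat; [now apply Rabs_le | rewrite Rabs_right; lra]. }
lra.
Qed.

Fixpoint Cpoly (c : nat -> C) (k : nat) (x : C) : C :=
  match k with
  | O => 0
  | S j => (Cpoly c j x + c j * x ^ j)%C
  end.

Lemma Cpoly_S c k x : Cpoly c (S k) x = (Cpoly c k x + c k * x ^ k)%C.
Proof. reflexivity. Qed.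

(** [1 / (z - x)] is the sum of [x ^ j / z ^ (j + 1)] for [j < k] and of
    [x ^ k / (z ^ k (z - x))]. *)
Lemma cap_int_expand T x k : (T ^ 2 > rho ^ 2 + x)%R -> 0 < x ->
  cap_int rho (fun z => f z / (z - RtoC x))%C T =
  (Cpoly (fun j => cap_int rho (fun z => f z / z ^ S j) T) k (RtoC x)
   + RtoC x ^ k * cap_int rho (fun z => f z / (z ^ k * (z - RtoC x))) T)%C.
Proof.
intros HT Hx.
assert (Z0 : forall s, - rho <= s <= rho ->
  (- (s, T) ^ 2)%C <> 0 /\ (- (s, T) ^ 2 - RtoC x)%C <> 0).
{ intros s Hs; split; intros E; apply (f_equal fst) in E; simpl in E; nra. }
induction k as [|k IH].
- simpl Cpoly; rewrite Cplus_0_l; simpl Cpow at 1; rewrite Cmult_1_l.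
  apply CInt_unique.
  eapply is_CInt_ext; [lra| |apply (is_CInt_cap (fun z => z ^ 0 * (z - RtoC x)))%C].
  + intros s Hs; cbv beta; destruct (Z0 s ltac:(lra)) as [Z1 Z2].
    set (z := (- (s, T) ^ 2)%C) in *; clearbody z; simpl Cpow.
    cfield; exact Z2.
  + intros z; apply ccont_mult; [apply ccont_const|].
    apply ccont_minus; [apply ccont_id | apply ccont_const].
  + intros s Hs; destruct (Z0 s Hs) as [Z1 Z2].
    apply Cmult_neq_0; [exact C1_nz | exact Z2].
- rewrite IH, Cpoly_S; cbv beta.
  set (D0 := fun z : C => (z ^ S k)%C).
  set (D1 := fun z : C => (z ^ S k * (z - RtoC x))%C).
  assert (E : cap_int rho (fun z => f z / (z ^ k * (z - RtoC x)))%C T =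
    (cap_int rho (fun z => f z / D0 z) T + RtoC x * cap_int rho (fun z => f z / D1 z) T)%C).
  { apply CInt_unique.
    eapply is_CInt_ext; [lra| |apply is_CInt_plus; [apply (is_CInt_cap D0)|
      apply is_CInt_scal, (is_CInt_cap D1)]].
    - intros s Hs; cbv beta; destruct (Z0 s ltac:(lra)) as [Z1 Z2].
      unfold D0, D1; set (z := (- (s, T) ^ 2)%C) in *.
      clearbody z; assert (Z3 := Cpow_nz z k Z1); rewrite !Cpow_S.
      cfield; repeat split; assumption.
    - intros z; apply ccont_pow, ccont_id.
    - intros s Hs; apply Cpow_nz, Z0, Hs.
    - intros z; apply ccont_mult; [apply ccont_pow, ccont_id|].
      apply ccont_minus; [apply ccont_id | apply ccont_const].
    - intros s Hs; destruct (Z0 s Hs) as [Z1 Z2].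
      apply Cmult_neq_0; [now apply Cpow_nz | exact Z2]. }
  rewrite E; unfold D0, D1; rewrite (Cpow_S (RtoC x)); ring.
Qed.

Lemma Cpoly_bound c k x m : 0 <= x -> (forall j, Cmod (c j) <= m) ->
  Cmod (Cpoly c k (RtoC x)) <= INR k * m * (1 + x) ^ k.
Proof.
intros Hx Hm; assert (Hm0 := Rle_trans _ _ _ (Cmod_ge_0 _) (Hm O)).
induction k as [|k IH]; [simpl; rewrite Cmod_0; lra|].
simpl Cpoly; eapply Rle_trans; [apply Cmod_triangle|].
rewrite Cmod_mult, Cmod_pow, Cmod_R, (Rabs_right x), S_INR by lra.
assert (P1 : x ^ k <= (1 + x) ^ S k) by (apply pow_le_one_plus; [exact Hx | lia]).
assert (P2 : (1 + x) ^ k <= (1 + x) ^ S k) by (apply Rle_pow; [lra | lia]).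
assert (P3 := pow_le x k Hx); assert (P4 := pos_INR k).
assert (P5 : Cmod (c k) * x ^ k <= m * (1 + x) ^ S k).
{ apply Rmult_le_compat; trivial; apply Cmod_ge_0. }
assert (P6 : INR k * m * (1 + x) ^ k <= INR k * m * (1 + x) ^ S k).
{ apply Rmult_le_compat_l; [now apply Rmult_le_pos | exact P2]. }
lra.
Qed.

End Growth.

(** * The Cauchy kernel on the truncated parabola *)

Lemma Rpower_neg_small A d e : 0 < A -> 0 < d -> 0 < e ->
  exists T1, 1 <= T1 /\ forall T, T1 <= T -> A * Rpower T (- d) <= e.
Proof.
intros HA Hd He; exists (Rmax 1 (exp (ln (A / e) / d))).
split; [apply Rmax_l|]; intros T HT.
assert (T1 := Rle_trans _ _ _ (Rmax_l _ _) HT).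
assert (T2 := Rle_trans _ _ _ (Rmax_r _ _) HT).
assert (HAe : 0 < A / e) by now apply Rdiv_lt_0_compat.
assert (L : ln (A / e) / d <= ln T).
{ rewrite <- (ln_exp (ln (A / e) / d)); apply Rcomplements.ln_le; [apply exp_pos | exact T2]. }
apply Rle_div_l in L; [|exact Hd].
apply Rmult_le_reg_l with (/ e); [now apply Rinv_0_lt_compat|].
rewrite <- Rmult_assoc, Rinv_l by lra.
replace (/ e * A) with (exp (ln (A / e))) by (rewrite exp_ln by exact HAe; unfold Rdiv; ring).
unfold Rpower; rewrite <- exp_plus, <- exp_0.
assert (Q : ln (A / e) + - d * ln T <= 0) by lra.
destruct Q as [Q|Q]; [left; now apply exp_increasing | rewrite Q; lra].
Qed.

Section Approximation.
Variables (rho beta K M : R) (f : C -> C).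
Hypothesis Hrho : 0 < rho.
Hypothesis Hf : analytic_within_and_on_parabola rho f.
Hypothesis HK : 0 < K.
Hypothesis Hgrow : forall z : C, in_parabola rho z -> M <= Cmod z ->
  Cmod (f z) <= K * Rpower (Cmod z) beta.

Lemma half_line_bound : exists B n, 0 < B /\
  forall x, 0 < x -> Cmod (f (RtoC x)) <= B * (1 + x) ^ n.
Proof.
destruct (strip_poly_bound rho beta K M f Hrho Hf HK Hgrow 0) as (B & n & HB & H).
{ rewrite Rabs_R0; lra. }
exists (B * 2 ^ n), n; split; [apply Rmult_lt_0_compat; [exact HB | apply pow_lt; lra]|].
intros x Hx.
assert (S0 := sqrt_pos x); assert (S := sqrt_sqrt x (Rlt_le _ _ Hx)).
replace (RtoC x) with (- (0, sqrt x) ^ 2)%C.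
2:{ unfold Copp, Cpow, Cmult, RtoC; simpl; f_equal; nra. }
apply Rle_trans with (1 := H (sqrt x)).
rewrite Rmult_assoc, <- Rpow_mult_distr; apply Rmult_le_compat_l; [lra|].
apply pow_incr; rewrite Rabs_right by lra; nra.
Qed.

Lemma parabola_bound : exists B n, 0 < B /\
  forall t, Cmod (f (parabola rho t) * parabola' rho t) <= B * (1 + Rabs t) ^ n.
Proof.
destruct (strip_poly_bound rho beta K M f Hrho Hf HK Hgrow rho) as (B & n & HB & H).
{ rewrite Rabs_right; lra. }
exists (B * (2 * (1 + rho))), (S n); split; [apply Rmult_lt_0_compat; lra|].
intros t; rewrite Cmod_mult.
replace (B * (2 * (1 + rho)) * (1 + Rabs t) ^ S n)
  with ((B * (1 + Rabs t) ^ n) * (2 * (1 + rho) * (1 + Rabs t))) by (simpl; ring).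
assert (At := Rabs_pos t).
apply Rmult_le_compat; try apply Cmod_ge_0; [apply H|].
unfold parabola'; rewrite Cmod_opp, !Cmod_mult, Cmod_Ci, Cmod_R, Rabs_right by lra.
assert (Q := Cmod_le_Rabs (rho, t)); simpl in Q; rewrite (Rabs_right rho) in Q by lra.
nra.
Qed.

Lemma parabola_integrand_cont t : ccont (fun t => f (parabola rho t) * parabola' rho t)%C t.
Proof.
apply (ccont_vertical (fun w => f (- w ^ 2) * (- (2 * Ci * w)))%C).
apply ccont_mult.
- apply Cdiff_cont, strip_Cdiff with rho; [exact Hf|]; simpl; rewrite Rabs_right; lra.
- apply ccont_opp, ccont_mult; [apply ccont_const | apply ccont_id].
Qed.

Lemma parabola_cont t : ccont (parabola rho) t.
Proof.
apply (ccont_vertical (fun w => - w ^ 2)%C); apply Cdiff_cont, Cdiff_neg_sqr.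
Qed.

Lemma is_CInt_kernel T x : 0 < x -> 0 <= T ->
  is_CInt (fun t => f (parabola rho t) * parabola' rho t / (parabola rho t - RtoC x))%C
    (- T) T (kernel_int rho f T x).
Proof.
intros Hx HT; apply is_CInt_cont; [lra|]; intros t _.
apply ccont_div; [apply parabola_integrand_cont| |now apply parabola_minus_neq0].
apply ccont_minus; [apply parabola_cont | apply ccont_const].
Qed.

Lemma kernel_int_cont T x : 0 < T -> 0 < x -> ccont (kernel_int rho f T) x.
Proof.
intros HT Hx.
apply (ccont_param_horizontal (fun w => f (parabola rho (fst w)) * parabola' rho (fst w)
  / (parabola rho (fst w) - RtoC (snd w)))%C (- T) T 0 (x + 1)); [lra | lra|].
intros t x' _ Hx'; apply ccont_div.
- apply (continuous_comp (fun w : C_UniformSpace => fst w)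
    (fun t => f (parabola rho t) * parabola' rho t)%C);
  [apply continuous_fst | apply parabola_integrand_cont].
- apply ccont_minus; [|apply ccont_RtoC, continuous_snd].
  apply (continuous_comp (fun w : C_UniformSpace => fst w) (parabola rho));
  [apply continuous_fst | apply parabola_cont].
- apply parabola_minus_neq0; simpl; lra.
Qed.

(** The half-line is the image of the imaginary axis of the strip. *)
Lemma half_line_cont x : 0 < x -> ccont (fun x : R => f (RtoC x)) x.
Proof.
intros Hx.
apply (continuous_ext_loc (fun x : R => f (RtoC x)) (fun x : R => f (- (0, sqrt x) ^ 2)%C)).
- apply locally_Rabs with x; [exact Hx|]; intros y Hy; f_equal.
  apply Rabs_lt_between in Hy.
  assert (S := sqrt_sqrt y ltac:(lra)).
  unfold Copp, Cpow, Cmult, RtoC; simpl; f_equal; nra.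
- apply (continuous_comp sqrt (fun t => f (- (0, t) ^ 2)%C)).
  + apply (ex_derive_continuous (K := R_AbsRing) (V := R_NormedModule)).
    auto_derive; exact Hx.
  + apply (ccont_vertical (fun w => f (- w ^ 2)%C)), Cdiff_cont.
    apply strip_Cdiff with rho; [exact Hf|]; simpl; rewrite Rabs_R0; lra.
Qed.

Lemma cap_coef_bound : exists B n T0, 0 < B /\ 1 <= T0 /\
  forall T j, T0 <= T ->
    Cmod (cap_int rho (fun z => f z / z ^ S j)%C T) <= B * (1 + T) ^ n.
Proof.
destruct (strip_growth rho beta K M f Hrho Hf HK Hgrow) as (B & T0 & HB & HT0 & HT0r & H).
destruct (INR_unbounded (2 * beta)) as [n Hn].
exists (8 * rho * B), (S n), T0; split; [repeat apply Rmult_lt_0_compat; lra|].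
split; [exact HT0|]; intros T j HT.
apply Rle_trans with (8 * rho * T * (B * (1 + T) ^ n)).
2:{ simpl; assert (P : 0 < (1 + T) ^ n) by (apply pow_lt; lra).
    assert (0 < 8 * rho * B * (1 + T) ^ n) by (repeat apply Rmult_lt_0_compat; lra); nra. }
assert (Zs : forall s, 1 <= Cmod (- (s, T) ^ 2)%C).
{ intros s; rewrite Cmod_neg_sqr; nra. }
assert (Z0 : forall s, ((- (s, T) ^ 2) ^ S j)%C <> 0).
{ intros s; apply Cpow_nz, Cmod_gt_0; specialize (Zs s); lra. }
apply (cap_int_bound rho f Hrho Hf (fun z => z ^ S j)%C); [lra| | |].
- intros z; apply ccont_pow, ccont_id.
- intros s _; apply Z0.
- intros s Hs; rewrite Cmod_div by apply Z0; rewrite Cmod_pow.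
  assert (Pj : 1 <= Cmod (- (s, T) ^ 2) ^ S j) by (apply pow_R1_Rle, Zs).
  assert (Hg := H s T ltac:(apply Rabs_le; lra) ltac:(rewrite Rabs_right; lra)).
  rewrite Rabs_right in Hg by lra.
  assert (Hp : Rpower T (2 * beta) <= (1 + T) ^ n).
  { apply Rle_trans with (Rpower T (INR n)); [apply Rle_Rpower; lra|].
    rewrite Rpower_pow by lra; apply pow_le_one_plus; [lra | apply Nat.le_refl]. }
  apply Rle_div_l; [lra|].
  assert (P : 0 < (1 + T) ^ n) by (apply pow_lt; lra).
  assert (Q : 0 < B * (1 + T) ^ n) by (apply Rmult_lt_0_compat; lra).
  apply Rle_trans with (B * (1 + T) ^ n); [|nra].
  apply Rle_trans with (1 := Hg); apply Rmult_le_compat_l; lra.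
Qed.

(** On the cap [|z|] and [|z - x|] are at least of the order of [T ^ 2], and [dz]
    contributes a factor [O(T)] over a segment of fixed length; the integral is
    therefore [O(T ^ (2 beta) * T ^ (- 2 k - 2) * T)], with negative
    exponent. *)
Lemma cap_remainder k : beta < INR k + 1 / 2 -> forall e, 0 < e ->
  exists T0, 1 <= T0 /\ forall T x, T0 <= T -> 0 < x <= T ^ 2 / 2 ->
    T ^ 2 > rho ^ 2 + x /\
    Cmod (cap_int rho (fun z => f z / (z ^ k * (z - RtoC x)))%C T) <= e.
Proof.
intros Hk e He.
destruct (strip_growth rho beta K M f Hrho Hf HK Hgrow) as (B & T0 & HB & HT0 & HT0r & H).
destruct (Rpower_neg_small (32 * rho * B) (2 * INR k + 1 - 2 * beta) e)
  as (T1 & HT1 & H1); trivial; [repeat apply Rmult_lt_0_compat; lra | lra|].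
exists (Rmax (Rmax T0 T1) (2 * rho)).
assert (Q1 := Rmax_l (Rmax T0 T1) (2 * rho)); assert (Q2 := Rmax_r (Rmax T0 T1) (2 * rho)).
assert (Q3 := Rmax_l T0 T1); assert (Q4 := Rmax_r T0 T1).
split; [lra|]; intros T x HT Hx.
assert (G : T ^ 2 > rho ^ 2 + x) by nra.
split; [exact G|].
assert (Re_le : forall s, - rho <= s <= rho ->
  T ^ 2 / 4 <= Cmod (- (s, T) ^ 2 - RtoC x)%C /\ T ^ 2 <= Cmod (- (s, T) ^ 2)%C).
{ intros s Hs; split; [|rewrite Cmod_neg_sqr; nra].
  assert (Q := re_le_Cmod (- (s, T) ^ 2 - RtoC x)%C).
  apply Rle_trans with (2 := Q); apply Rle_trans with (2 := Rle_abs _).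
  simpl; nra. }
assert (N : forall s, - rho <= s <= rho ->
  (- (s, T) ^ 2)%C <> 0 /\ (- (s, T) ^ 2 - RtoC x)%C <> 0).
{ intros s Hs; destruct (Re_le s Hs); split; apply Cmod_gt_0; nra. }
assert (HTpos : 0 < T) by lra.
assert (ET : Rpower T (2 * beta) = Rpower T (- (2 * INR k + 1 - 2 * beta)) * (T ^ (2 * k) * T)).
{ replace (T ^ (2 * k) * T) with (T ^ (2 * k + 1)) by (rewrite pow_add; ring).
  rewrite <- Rpower_pow, <- Rpower_plus by exact HTpos.
  f_equal; rewrite plus_INR, mult_INR; simpl; ring. }
set (E := Rpower T (- (2 * INR k + 1 - 2 * beta))) in *.
apply Rle_trans with (8 * rho * T * (4 * B * E / T)).
2:{ apply Rle_trans with (2 := H1 T ltac:(lra)); apply Req_le; fold E; field; lra. }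
apply (cap_int_bound rho f Hrho Hf (fun z => z ^ k * (z - RtoC x))%C); [lra| | |].
- intros z; apply ccont_mult; [apply ccont_pow, ccont_id|].
  apply ccont_minus; [apply ccont_id | apply ccont_const].
- intros s Hs; apply Cmult_neq_0; [apply Cpow_nz|]; now apply N.
- intros s Hs; destruct (N s Hs) as [N1 N2], (Re_le s Hs) as [L1 L2].
  rewrite Cmod_div, Cmod_mult, Cmod_pow by (apply Cmult_neq_0; [apply Cpow_nz|]; assumption).
  assert (Hg := H s T ltac:(apply Rabs_le; lra) ltac:(rewrite Rabs_right; lra)).
  rewrite Rabs_right, ET in Hg by lra.
  assert (Pk : 0 < T ^ (2 * k)) by now apply pow_lt.
  assert (L3 : T ^ (2 * k) <= Cmod (- (s, T) ^ 2) ^ k).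
  { rewrite pow_mult; apply pow_incr; nra. }
  assert (E0 : 0 < E) by apply exp_pos.
  apply Rle_div_l; [apply Rmult_lt_0_compat; nra|].
  apply Rle_trans with (1 := Hg).
  apply Rle_trans with (4 * B * E / T * (T ^ (2 * k) * (T ^ 2 / 4))).
  + apply Req_le; field; lra.
  + apply Rmult_le_compat_l.
    * apply Rlt_le, Rdiv_lt_0_compat; [repeat apply Rmult_lt_0_compat|]; lra.
    * apply Rmult_le_compat; nra.
Qed.

(** On the parabola the Cauchy kernel reproduces [f x] up to a polynomial of
    degree less than [k] and an error that is small against one fixed power of
    [1 + x], uniformly in [x].  For [x <= T ^ 2 / 2] the error is the
    remainder of the cap; for larger [x] each term has polynomial growth in
    [x] and [T <= 1 + x], so that the factor [(1 + x) / T >= 1] may be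
    inserted. *)
Lemma kernel_int_approx k : beta < INR k + 1 / 2 ->
  exists n, forall e, 0 < e -> exists T0, 1 <= T0 /\ forall T, T0 <= T ->
    exists c, forall x, 0 < x ->
      Cmod (kernel_int rho f T x - 2 * RtoC PI * Ci * f (RtoC x) - Cpoly c k (RtoC x))
      <= e * (1 + x) ^ n.
Proof.
intros Hk.
destruct half_line_bound as (B1 & n1 & HB1 & H1).
destruct parabola_bound as (B2 & n2 & HB2 & H2).
destruct cap_coef_bound as (B3 & n3 & T3 & HB3 & HT3 & H3).
set (Ctot := 2 * B2 * 2 ^ n2 * 2 / rho ^ 2 + 2 * PI * B1 + INR k * (B3 * 2 ^ n3)).
set (N := (S n2 + n1 + n3 + k)%nat).
assert (HPI := PI_RGT_0).
assert (Hr2 : 0 < rho ^ 2) by (apply pow_lt; lra).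
assert (P2 : forall n, 0 < 2 ^ n) by (intros n; apply pow_lt; lra).
assert (HC1 : 0 < 2 * B2 * 2 ^ n2 * 2 / rho ^ 2).
{ apply Rdiv_lt_0_compat; trivial.
  assert (Q := P2 n2); repeat apply Rmult_lt_0_compat; lra. }
assert (HC2 : 0 < 2 * PI * B1) by (apply Rmult_lt_0_compat; lra).
assert (HC3 : 0 <= INR k * (B3 * 2 ^ n3)).
{ apply Rmult_le_pos; [apply pos_INR|]; apply Rlt_le, Rmult_lt_0_compat; trivial. }
exists (S N); intros e He.
destruct (cap_remainder k Hk e He) as (T4 & HT4 & H4).
set (T0 := Rmax (Rmax T3 T4) (Ctot / e)).
assert (Q1 := Rmax_l (Rmax T3 T4) (Ctot / e)); assert (Q2 := Rmax_r (Rmax T3 T4) (Ctot / e)).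
assert (Q3 := Rmax_l T3 T4); assert (Q4 := Rmax_r T3 T4); fold T0 in Q1, Q2.
exists T0; split; [lra|]; intros T HT.
set (c := fun j => cap_int rho (fun z => f z / z ^ S j)%C T).
exists c; intros x Hx.
assert (X1 : forall n, 1 <= (1 + x) ^ n) by (intros n; apply pow_R1_Rle; lra).
destruct (Rle_dec x (T ^ 2 / 2)) as [Hs|Hl].
- destruct (H4 T x ltac:(lra) ltac:(lra)) as [G R4].
  rewrite (kernel_int_residue rho f T x Hrho Hf) by nra.
  rewrite (cap_int_expand rho f Hrho Hf T x k G Hx); fold c.
  set (R := cap_int rho (fun z => f z / (z ^ k * (z - RtoC x)))%C T) in *.
  match goal with |- Cmod ?D <= _ => replace D with (RtoC x ^ k * R)%C by ring end.
  rewrite Cmod_mult, Cmod_pow, Cmod_R, (Rabs_right x), Rmult_comm by lra.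
  apply Rmult_le_compat; [apply Cmod_ge_0 | apply pow_le; lra | exact R4 |].
  apply pow_le_one_plus; [lra | unfold N; lia].
- assert (TX : 1 + T <= 2 * (1 + x)) by nra.
  assert (TX' : T <= 1 + x) by nra.
  assert (PT : forall n, (1 + T) ^ n <= 2 ^ n * (1 + x) ^ n).
  { intros n; rewrite <- Rpow_mult_distr; apply pow_incr; lra. }
  assert (XN : forall n, (n <= N)%nat -> (1 + x) ^ n <= (1 + x) ^ N).
  { intros n Hn; apply Rle_pow; [lra | exact Hn]. }
  assert (A1 : Cmod (kernel_int rho f T x) <= 2 * B2 * 2 ^ n2 * 2 / rho ^ 2 * (1 + x) ^ N).
  { apply Rle_trans with (B2 * (1 + T) ^ n2 / rho ^ 2 * (T - - T)).
    - eapply is_CInt_norm_const; [lra | | apply is_CInt_kernel; lra].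
      intros t Ht; cbv beta.
      assert (Dt := parabola_dist rho t x Hrho Hx).
      rewrite Cmod_div by now apply parabola_minus_neq0.
      apply Rmult_le_compat; [apply Cmod_ge_0 | apply Rlt_le, Rinv_0_lt_compat; lra | |].
      + apply Rle_trans with (1 := H2 t); apply Rmult_le_compat_l; [lra|].
        assert (Q := Rabs_pos t).
        apply pow_incr; split; [lra|]; apply Rplus_le_compat_l, Rabs_le, Ht.
      + apply Rinv_le_contravar; lra.
    - apply Rle_trans with (B2 * (2 ^ n2 * (1 + x) ^ n2) / rho ^ 2 * (4 * (1 + x))).
      + apply Rmult_le_compat; try lra.
        * apply Rdiv_le_0_compat; [|exact Hr2]; apply Rmult_le_pos; [lra | apply pow_le; lra].
        * apply Rmult_le_compat_r; [apply Rlt_le, Rinv_0_lt_compat; lra|].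
          apply Rmult_le_compat_l; [lra | apply PT].
      + replace (B2 * (2 ^ n2 * (1 + x) ^ n2) / rho ^ 2 * (4 * (1 + x)))
          with (2 * B2 * 2 ^ n2 * 2 / rho ^ 2 * (1 + x) ^ S n2) by (simpl; field; lra).
        apply Rmult_le_compat_l; [lra | apply XN; unfold N; lia]. }
  assert (A2 : Cmod (2 * RtoC PI * Ci * f (RtoC x)) <= 2 * PI * B1 * (1 + x) ^ N).
  { rewrite !Cmod_mult, Cmod_Ci, !Cmod_R, !Rabs_right, Rmult_1_r by lra.
    rewrite (Rmult_assoc (2 * PI)); apply Rmult_le_compat_l; [lra|].
    apply Rle_trans with (1 := H1 x Hx); apply Rmult_le_compat_l; [lra|].
    apply XN; unfold N; lia. }
  assert (A3 : Cmod (Cpoly c k (RtoC x)) <= INR k * (B3 * 2 ^ n3) * (1 + x) ^ N).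
  { apply Rle_trans with (INR k * (B3 * (1 + T) ^ n3) * (1 + x) ^ k).
    - apply (Cpoly_bound c k x (B3 * (1 + T) ^ n3)); [lra|]; intros j; apply (H3 T j); lra.
    - apply Rle_trans with (INR k * (B3 * (2 ^ n3 * (1 + x) ^ n3)) * (1 + x) ^ k).
      + apply Rmult_le_compat_r; [apply pow_le; lra|].
        apply Rmult_le_compat_l; [apply pos_INR|].
        apply Rmult_le_compat_l; [lra | apply PT].
      + replace (INR k * (B3 * (2 ^ n3 * (1 + x) ^ n3)) * (1 + x) ^ k)
          with (INR k * (B3 * 2 ^ n3) * (1 + x) ^ (n3 + k)) by (rewrite pow_add; ring).
        apply Rmult_le_compat_l; [exact HC3 | apply XN; unfold N; lia]. }
  apply Rle_trans with (Ctot * (1 + x) ^ N).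
  + unfold Cminus; eapply Rle_trans; [apply Cmod_triangle|]; rewrite Cmod_opp.
    eapply Rle_trans; [apply Rplus_le_compat_r, Cmod_triangle|]; rewrite Cmod_opp.
    unfold Ctot; lra.
  + rewrite <- tech_pow_Rmult, <- Rmult_assoc.
    apply Rmult_le_compat_r; [apply pow_le; lra|].
    assert (QC : Ctot / e <= T) by lra.
    apply Rle_div_l in QC; [|exact He]; nra.
Qed.

End Approximation.

(** * The Cauchy transform along the parabola *)

Lemma weight_Laguerre_dominated alpha k n : -1 < alpha ->
  exists K, 0 <= K /\ forall x, 0 < x ->
    Rabs (Laguerre_weight alpha x * Laguerre alpha k x) * (1 + x) ^ n
    <= K * dom_density alpha x.
Proof.
intros Ha.
destruct (Laguerre_bound alpha k) as (KL & HKL & HL).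
destruct (weight_dominated alpha (k + n) Ha) as (KW & HKW & HW).
exists (KL * KW); split; [apply Rmult_le_pos; lra|]; intros x Hx.
assert (W := weight_pos alpha x).
rewrite Rabs_mult, (Rabs_right (Laguerre_weight alpha x)) by lra.
apply Rle_trans with (KL * (Laguerre_weight alpha x * (1 + x) ^ (k + n))).
- rewrite pow_add.
  apply Rle_trans with (Laguerre_weight alpha x * (KL * (1 + x) ^ k) * (1 + x) ^ n).
  + apply Rmult_le_compat_r; [apply pow_le; lra|].
    apply Rmult_le_compat_l; [lra | apply HL; lra].
  + apply Req_le; ring.
- rewrite Rmult_assoc; apply Rmult_le_compat_l; [exact HKL | now apply HW].
Qed.

Lemma weight_Laguerre_cont alpha k x : 0 < x ->
  continuous (fun x => Laguerre_weight alpha x * Laguerre alpha k x) x.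
Proof.
intros Hx; apply (continuous_mult (K := R_AbsRing)); [now apply weight_cont|].
apply Laguerre_cont.
Qed.

Section Transform.
Variables (alpha : R) (k : nat).
Hypothesis Halpha : -1 < alpha.

Let wL (x : R) : R := Laguerre_weight alpha x * Laguerre alpha k x.

Lemma is_CInt_pos_wL n : exists K, 0 <= K /\ forall (h : R -> C) m,
  0 <= m -> (forall x, 0 < x -> ccont h x) ->
  (forall x, 0 < x -> Cmod (h x) <= m * (1 + x) ^ n) ->
  (exists l, is_CInt_pos (fun x => RtoC (wL x) * h x)%C l) /\
  (forall l, is_CInt_pos (fun x => RtoC (wL x) * h x)%C l -> Cmod l <= m * K).
Proof.
destruct (weight_Laguerre_dominated alpha k n Halpha) as (K & HK & HD).
exists K; split; [exact HK|].
apply (dominated_weight alpha wL n K Halpha); [|exact HD].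
intros x Hx; now apply weight_Laguerre_cont.
Qed.

Lemma is_CInt_pos_wL_Cpoly c j : (j <= k)%nat ->
  is_CInt_pos (fun x => RtoC (wL x) * Cpoly c j (RtoC x))%C (RtoC 0).
Proof.
induction j as [|j IH]; intros Hj.
- apply is_CInt_pos_iff; intros e He; exists 1, 1; split; [lra|]; intros a b Ha Hb.
  exists (RtoC 0 * RtoC (b - a))%C; split.
  + apply is_CInt_ext with (fun _ => RtoC 0); [lra | intros t _; simpl; cring | apply is_CInt_const].
  + replace (RtoC 0 * RtoC (b - a) - RtoC 0)%C with (RtoC 0) by ring; now rewrite Cmod_0.
- assert (H := is_CInt_pos_plus _ _ _ _ (IH ltac:(lia))
    (is_CInt_pos_scal _ _ (c j) (Laguerre_orthogonal alpha k j Halpha ltac:(lia)))).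
  replace (RtoC 0 + c j * RtoC 0)%C with (RtoC 0) in H by ring.
  revert H; apply is_CInt_pos_ext; intros x _; fold (wL x).
  rewrite Cpoly_S, RtoC_pow; cring.
Qed.

Lemma Cpoly_cont c j x : ccont (fun x : R => Cpoly c j (RtoC x)) x.
Proof.
induction j as [|j IH]; [apply ccont_const|].
apply ccont_plus; [exact IH|]; apply ccont_mult; [apply ccont_const|].
apply ccont_pow, ccont_RtoC, continuous_id.
Qed.

Variable rho : R.
Hypothesis Hrho : 0 < rho.

(** [2 PI i] times [Laguerre_Phi], as a function of the parameter of the parabola. *)
Definition Psi (t : R) : C :=
  CInt_pos (fun x => RtoC (wL x) / (parabola rho t - RtoC x))%C.

Lemma inv_parabola_cont t x : 0 < x -> ccont (fun x => / (parabola rho t - RtoC x))%C x.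
Proof.
intros Hx; apply ccont_inv; [|now apply parabola_minus_neq0].
apply ccont_minus; [apply ccont_const | apply ccont_RtoC, continuous_id].
Qed.

Lemma inv_parabola_bound t x : 0 < x ->
  Cmod (/ (parabola rho t - RtoC x))%C <= / rho ^ 2.
Proof.
intros Hx; rewrite Cmod_inv by now apply parabola_minus_neq0.
apply Rinv_le_contravar; [apply pow_lt; lra | now apply parabola_dist].
Qed.

Lemma Psi_correct t :
  is_CInt_pos (fun x => RtoC (wL x) / (parabola rho t - RtoC x))%C (Psi t).
Proof.
destruct (is_CInt_pos_wL 0) as (K & _ & HB).
destruct (HB (fun x => / (parabola rho t - RtoC x))%C (/ rho ^ 2)) as [[l Hl] _].
- apply Rlt_le, Rinv_0_lt_compat, pow_lt, Hrho.
- intros x Hx; now apply inv_parabola_cont.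
- intros x Hx; rewrite pow_O, Rmult_1_r; now apply inv_parabola_bound.
- assert (E : Psi t = l) by exact (CInt_pos_unique _ _ Hl).
  rewrite E; exact Hl.
Qed.

(** The resolvent identity and the distance [rho ^ 2] make [Psi] Lipschitz in
    the point of the parabola. *)
Lemma Psi_cont t : ccont Psi t.
Proof.
destruct (is_CInt_pos_wL 0) as (K & HK & HB).
assert (Hr2 : 0 < / rho ^ 2) by (apply Rinv_0_lt_compat, pow_lt, Hrho).
assert (Lip : forall t', Cmod (Psi t' - Psi t) <=
  Cmod (parabola rho t' - parabola rho t) * (/ rho ^ 2 * / rho ^ 2 * K)).
{ intros t'.
  rewrite <- !Rmult_assoc.
  apply (HB (fun x => / (parabola rho t' - RtoC x) - / (parabola rho t - RtoC x))%C).
  - apply Rmult_le_pos; [apply Rmult_le_pos; [apply Cmod_ge_0|]|]; lra.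
  - intros x Hx; apply ccont_minus; now apply inv_parabola_cont.
  - intros x Hx; rewrite pow_O, Rmult_1_r.
    assert (N1 := parabola_minus_neq0 rho t x Hrho Hx).
    assert (N2 := parabola_minus_neq0 rho t' x Hrho Hx).
    replace (/ (parabola rho t' - RtoC x) - / (parabola rho t - RtoC x))%C
      with (- (parabola rho t' - parabola rho t) * / (parabola rho t' - RtoC x)
            * / (parabola rho t - RtoC x))%C by (field; split; assumption).
    rewrite !Cmod_mult, Cmod_opp.
    apply Rmult_le_compat; try apply Cmod_ge_0.
    + apply Rmult_le_pos; apply Cmod_ge_0.
    + apply Rmult_le_compat_l; [apply Cmod_ge_0 | now apply inv_parabola_bound].
    + now apply inv_parabola_bound.
  - assert (H := is_CInt_pos_minus _ _ _ _ (Psi_correct t') (Psi_correct t)).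
    revert H; apply is_CInt_pos_ext; intros x _; unfold Cdiv; cring. }
apply ccont_of_near; intros e He.
set (L := / rho ^ 2 * / rho ^ 2 * K) in *.
assert (HL : 0 <= L) by (unfold L; apply Rmult_le_pos; [apply Rlt_le, Rmult_lt_0_compat|]; lra).
assert (He' : 0 < e / (L + 1)) by (apply Rdiv_lt_0_compat; lra).
generalize (ccont_near _ _ _ He' (parabola_cont rho t)); apply filter_imp.
intros t' Ht'; eapply Rle_lt_trans; [apply Lip|].
apply Rlt_div_r in Ht'; [|lra].
assert (Q := Cmod_ge_0 (parabola rho t' - parabola rho t)); nra.
Qed.

Variable f : C -> C.
Hypothesis Hf : analytic_within_and_on_parabola rho f.

(** Exchange of the half-line integral and the truncated contour
    integral: on [[a, b]] this is Fubini for a rectangle, and the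
    remaining tails are small uniformly on the contour. *)
Lemma Psi_contour_int T : 0 < T ->
  is_CInt_pos (fun x => RtoC (wL x) * kernel_int rho f T x)%C
    (CInt (fun t => Psi t * (f (parabola rho t) * parabola' rho t))%C (- T) T).
Proof.
intros HT.
set (v := fun t => (f (parabola rho t) * parabola' rho t)%C).
assert (Cv : forall t, ccont v t) by (intros t; now apply parabola_integrand_cont).
destruct (bounded_continuity (V := C_R_NormedModule) v (- T) T) as [V0 HV0].
{ intros t _; apply Cv. }
set (V := Rabs V0).
assert (HV : forall t, - T <= t <= T -> Cmod (v t) <= V).
{ intros t Ht; rewrite Cmod_norm; apply Rle_trans with V0; [|apply Rle_abs].
  apply Rlt_le, HV0, Ht. }
assert (V0' : 0 <= V) by apply Rabs_pos.
assert (Hr2 : 0 < / rho ^ 2) by (apply Rinv_0_lt_compat, pow_lt, Hrho).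
destruct (weight_Laguerre_dominated alpha k 0 Halpha) as (K & HK & HD).
set (D := K * / rho ^ 2).
assert (HD0 : 0 <= D) by (apply Rmult_le_pos; lra).
set (q := fun t x => (RtoC (wL x) / (parabola rho t - RtoC x))%C).
assert (Cq : forall t x, 0 < x -> ccont (q t) x).
{ intros t x Hx; apply ccont_mult; [|now apply inv_parabola_cont].
  apply ccont_RtoC; now apply weight_Laguerre_cont. }
assert (Dq : forall t x, 0 < x -> Cmod (q t x) <= D * dom_density alpha x).
{ intros t x Hx; unfold q, Cdiv; rewrite Cmod_mult, Cmod_R.
  specialize (HD x Hx); simpl in HD; rewrite Rmult_1_r in HD; fold (wL x) in HD.
  unfold D; replace (K * / rho ^ 2 * dom_density alpha x)
    with (K * dom_density alpha x * / rho ^ 2) by ring.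
  apply Rmult_le_compat; [apply Rabs_pos | apply Cmod_ge_0 | exact HD |].
  now apply inv_parabola_bound. }
assert (Cg : forall x t, 0 < x -> ccont (fun w : C => q (snd w) (fst w) * v (snd w))%C ((x, t) : C)).
{ intros x t Hx; unfold q; apply ccont_mult.
  - apply ccont_div.
    + apply ccont_RtoC.
      apply (continuous_comp (fun w : C_UniformSpace => fst w) wL); [apply continuous_fst|].
      now apply weight_Laguerre_cont.
    + apply ccont_minus.
      * apply (continuous_comp (fun w : C_UniformSpace => snd w) (parabola rho));
          [apply continuous_snd | apply parabola_cont].
      * apply ccont_RtoC, continuous_fst.
    + now apply parabola_minus_neq0.
  - apply (continuous_comp (fun w : C_UniformSpace => snd w) v); [apply continuous_snd | apply Cv]. }
assert (Ck : forall x, 0 < x -> ccont (fun x => RtoC (wL x) * kernel_int rho f T x)%C x).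
{ intros x Hx; apply ccont_mult; [apply ccont_RtoC; now apply weight_Laguerre_cont|].
  now apply kernel_int_cont. }
apply is_CInt_pos_iff; intros e He.
set (L := D * V * (T - - T)).
assert (HL : 0 <= L) by (unfold L; apply Rmult_le_pos; [now apply Rmult_le_pos | lra]).
assert (He' : 0 < e / (2 * (L + 1))) by (apply Rdiv_lt_0_compat; lra).
destruct (dom_cdf_near0 alpha Halpha _ He') as (d & Hd & H0).
destruct (dom_cdf_near_infty alpha Halpha _ He') as (B & HB & H1).
exists d, (Rmax B d); split; [exact Hd|]; intros a b Ha Hb.
assert (B1 := Rmax_l B d); assert (B2 := Rmax_r B d).
exists (CInt (fun x => RtoC (wL x) * kernel_int rho f T x)%C a b); split.
{ apply is_CInt_cont; [lra|]; intros x Hx; apply Ck; lra. }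
assert (E1 : CInt (fun x => RtoC (wL x) * kernel_int rho f T x)%C a b =
  CInt (fun x => CInt (fun t => q t x * v t)%C (- T) T) a b).
{ symmetry; apply CInt_unique.
  apply is_CInt_ext with (fun x => RtoC (wL x) * kernel_int rho f T x)%C; [lra| |].
  - intros x Hx; cbv beta; apply eq_sym, CInt_unique.
    apply is_CInt_ext with (fun t => RtoC (wL x) * (v t / (parabola rho t - RtoC x)))%C; [lra| |].
    + intros t _; unfold q, Cdiv; cring.
    + apply is_CInt_scal, is_CInt_kernel; trivial; lra.
  - apply is_CInt_cont; [lra|]; intros x Hx; apply Ck; lra. }
assert (E2 := Fubini_rect (fun w => q (snd w) (fst w) * v (snd w))%C
  0 (b + 1) (- T - 1) (T + 1) a b (- T) T ltac:(lra) ltac:(lra) ltac:(lra) ltac:(lra)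
  ltac:(lra) ltac:(lra) ltac:(intros s t ? ?; apply Cg; lra)).
cbn [fst snd] in E2; rewrite E1, E2.
assert (Ei : forall t, CInt (fun x => q t x * v t)%C a b = (v t * CInt (q t) a b)%C).
{ intros t; apply CInt_unique.
  apply is_CInt_ext with (fun x => v t * q t x)%C; [lra | intros x _; cring|].
  apply is_CInt_scal, is_CInt_cont; [lra|]; intros x Hx; apply Cq; lra. }
apply Rle_lt_trans with (V * (D * (dom_cdf alpha a + (1 - dom_cdf alpha b))) * (T - - T)).
- eapply (is_CInt_norm_const
    (fun t => CInt (fun x => q t x * v t)%C a b - Psi t * v t)%C); [lra| |].
  + intros t Ht; rewrite Ei.
    replace (v t * CInt (q t) a b - Psi t * v t)%C
      with (v t * - (Psi t - CInt (q t) a b))%C by ring.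
    rewrite Cmod_mult, Cmod_opp.
    apply Rmult_le_compat; try apply Cmod_ge_0; [now apply HV|].
    apply dominated_tail; trivial; try lra; [apply Cq | apply Dq | apply Psi_correct].
  + apply is_CInt_minus; apply is_CInt_cont; try lra; intros t Ht.
    * apply (ccont_param_horizontal (fun w => q (snd w) (fst w) * v (snd w))%C a b
        (- T - 1) (T + 1) t); try lra.
      intros x t' Hx _; apply Cg; lra.
    * apply ccont_mult; [apply Psi_cont | apply Cv].
- specialize (H0 a Ha); specialize (H1 b ltac:(lra)).
  set (r := e / (2 * (L + 1))) in *.
  assert (Er : r * (L + 1) = e / 2) by (unfold r; field; lra).
  replace (V * (D * (dom_cdf alpha a + (1 - dom_cdf alpha b))) * (T - - T))
    with (L * (dom_cdf alpha a + (1 - dom_cdf alpha b))) by (unfold L; ring).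
  nra.
Qed.

End Transform.

(** * The Laguerre coefficient as a contour integral *)

Lemma beta_lt_of_Int_part beta k :
  (Z.max (Int_part (beta - 1 / 2) + 1) 0 <= Z.of_nat k)%Z -> beta < INR k + 1 / 2.
Proof.
intros H; destruct (base_Int_part (beta - 1 / 2)) as [_ H2].
assert (H3 : (Int_part (beta - 1 / 2) + 1 <= Z.of_nat k)%Z) by lia.
apply IZR_le in H3; rewrite plus_IZR in H3; rewrite INR_IZR_INZ; lra.
Qed.

Theorem theorem3p1 :
  forall (alpha rho : R) (f : C -> C) (beta K : R),
  -1 < alpha ->
  0 < rho ->
  analytic_within_and_on_parabola rho f ->
  0 < K ->
  (exists M : R, forall z : C,
     in_parabola rho z -> M <= Cmod z ->
     Cmod (f z) <= K * Rpower (Cmod z) beta) ->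
  forall k : nat,
  (Z.max (Int_part (beta - 1 / 2) + 1) 0 <= Z.of_nat k)%Z ->
  ex_parabola_int rho (fun z => Laguerre_Phi alpha k z * f z)%C /\
  Laguerre_coef alpha f k =
    (/ RtoC (Laguerre_gamma alpha k) *
     parabola_int rho (fun z => Laguerre_Phi alpha k z * f z))%C.
Proof.
intros alpha rho f beta K Ha Hr Hf HK [M Hgrow] k Hk.
apply beta_lt_of_Int_part in Hk.
set (tpi := (2 * RtoC PI * Ci)%C).
assert (HPI := PI_RGT_0).
assert (Ntpi : tpi <> 0).
{ intros E; apply (f_equal snd) in E; unfold tpi in E; simpl in E; lra. }
assert (Ctpi : 0 < Cmod tpi) by now apply Cmod_gt_0.
destruct (half_line_bound rho beta K M f Hr Hf HK Hgrow) as (B1 & n1 & HB1 & H1).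
assert (Cf := half_line_cont rho f Hr Hf).
destruct (is_CInt_pos_wL alpha k Ha n1) as (K1 & _ & E1).
destruct (E1 (fun x => f (RtoC x)) B1 ltac:(lra) Cf H1) as [[J HJ] _].
assert (Hlim : is_parabola_int rho (fun z => Laguerre_Phi alpha k z * f z)%C J).
{ set (I := fun T => CInt (fun t => Psi alpha k rho t *
    (f (parabola rho t) * parabola' rho t))%C (- T) T).
  destruct (kernel_int_approx rho beta K M f Hr Hf HK Hgrow k Hk) as [n Happ].
  destruct (is_CInt_pos_wL alpha k Ha n) as (KB & HKB & Hbd).
  intros P HP; destruct (proj1 (locally_Cmod J P) HP) as (e & He & HPe).
  assert (He' : 0 < e * Cmod tpi / (KB + 1)).
  { apply Rdiv_lt_0_compat; [now apply Rmult_lt_0_compat | lra]. }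
  destruct (Happ _ He') as (T0 & HT0 & Hap).
  exists T0; intros T HT.
  destruct (Hap T (Rlt_le _ _ HT)) as [c Hc].
  exists (/ tpi * I T)%C; split.
  - apply is_CInt_ext with (fun t => / tpi * (Psi alpha k rho t *
      (f (parabola rho t) * parabola' rho t)))%C; [lra| |].
    + intros t _; unfold Laguerre_Phi, Psi, tpi; cring.
    + apply is_CInt_scal, is_CInt_cont; [lra|]; intros t _.
      apply ccont_mult; [now apply Psi_cont | now apply parabola_integrand_cont].
  - apply HPe.
    (* The kernel integral minus its approximation, against the weight times
       [L_k]: orthogonality removes the polynomial from the value. *)
    assert (Hint := is_CInt_pos_minus _ _ _ _ (is_CInt_pos_minus _ _ _ _
      (Psi_contour_int alpha k Ha rho Hr f Hf T ltac:(lra))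
      (is_CInt_pos_scal _ _ tpi HJ))
      (is_CInt_pos_wL_Cpoly alpha k Ha c k (Nat.le_refl k))).
    fold (I T) in Hint.
    assert (Hsmall : Cmod (I T - tpi * J - RtoC 0) <= e * Cmod tpi / (KB + 1) * KB).
    { apply (Hbd (fun x => kernel_int rho f T x - tpi * f (RtoC x) - Cpoly c k (RtoC x))%C);
        [lra | | exact Hc |].
      - intros x Hx; apply ccont_minus; [apply ccont_minus|apply Cpoly_cont].
        + apply kernel_int_cont; trivial; lra.
        + apply ccont_mult; [apply ccont_const | now apply Cf].
      - revert Hint; apply is_CInt_pos_ext; intros x _; cring. }
    replace (/ tpi * I T - J)%C with (/ tpi * (I T - tpi * J - RtoC 0))%C
      by (field; exact Ntpi).
    rewrite Cmod_mult, Cmod_inv by exact Ntpi.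
    apply Rmult_lt_reg_l with (Cmod tpi); [exact Ctpi|].
    rewrite <- Rmult_assoc, Rinv_r, Rmult_1_l by lra.
    apply Rle_lt_trans with (1 := Hsmall).
    apply Rmult_lt_reg_r with (KB + 1); [lra|].
    replace (e * Cmod tpi / (KB + 1) * KB * (KB + 1)) with (e * Cmod tpi * KB) by (field; lra).
    assert (Q : 0 < e * Cmod tpi) by now apply Rmult_lt_0_compat.
    nra. }
split; [now exists J|].
assert (EJ : parabola_int rho (fun z => Laguerre_Phi alpha k z * f z)%C = J).
{ unfold parabola_int; apply (iota_unique (V := C_R_CompleteNormedModule)).
  - intros y Hy.
    refine (filterlimi_locally_unique (V := C_R_NormedModule) _ y J _ Hy Hlim).
    apply filter_forall; intros T y1 y2 Y1 Y2.
    rewrite <- (CInt_unique _ _ _ _ Y1); exact (CInt_unique _ _ _ _ Y2).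
  - exact Hlim. }
rewrite EJ; unfold Laguerre_coef; f_equal; apply CInt_pos_unique.
revert HJ; apply is_CInt_pos_ext; intros x _; rewrite RtoC_mult; cring.
Qed.
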